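(* Let $k$ be an algebraically closed field, $C$ a connected smooth projective curve over $k$ with generic point $\eta$, $e$ and $v$ positive integers, and $\rho:GL_{e,k}\to GL_{v,k}$ a morphism of algebraic $k$-groups which is homogeneous of weight $\gamma\in\mathbb{Z}$ (i.e. $\rho(t\,\mathrm{Id}_e)=t^\gamma\,\mathrm{Id}_v$ for all $t\in k^*$). Let $E$ be a vector bundle of rank $e$ over $C$ whose generic fiber $E_\eta$ is trivialized, so that $\mathbb{P}^{v-1}_{k(C)}\simeq\mathbb{P}(E^\rho_\eta)$. For every point $P\in\mathbb{P}^{v-1}_{k,ss}(k(C))$, $$\mathrm{ht}_{GIT}(P)\le\mathrm{ht}_{\mathbb{P}(E^\rho)}(P).$$ Moreover, equality holds if and only if the unique extension $\overline{P}$ of $P$ to a section of $\mathbb{P}(E^\rho)$ over $C$ takes its values in the Zariski open subscheme $\mathbb{P}(E^\rho)_{ss}$ of $\mathbb{P}(E^\rho)$.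
   Context: Conventions. For a vector bundle $V$, $\mathbb{P}(V):=\mathrm{Proj}\,S^\bullet V^\vee$, with tautological line bundle $\mathcal{O}_V(1)$; $\mathbb{P}^{v-1}_k=\mathbb{P}(k^v)$. $\mu(E)=\deg_C E/\mathrm{rk}\,E$. GIT quotient. $SL_{e,k}$ acts through $\rho$ on $\mathbb{P}^{v-1}_k$ and on $\bigoplus_i\Gamma(\mathbb{P}^{v-1}_k,\mathcal{O}(i))=S^\bullet(k^v)^\vee$. The semistable locus $\mathbb{P}^{v-1}_{k,ss}$ is the open complement of the intersection of the base loci of $\Gamma(\mathbb{P}^{v-1}_k,\mathcal{O}(i))^{SL_{e,k}}$, $i>0$. Let $q:\mathbb{P}^{v-1}_{k,ss}\to M(\rho):=\mathrm{Proj}\bigoplus_{i\ge0}\Gamma(\mathbb{P}^{v-1}_k,\mathcal{O}(i))^{SL_{e,k}}$ be the quotient morphism; $M(\rho)$ is projective and carries an ample $\mathbb{Q}$-line bundle $L$ with $q^*L\simeq\mathcal{O}(1)_{|\mathbb{P}^{v-1}_{k,ss}}$. GIT height. For $P\in\mathbb{P}^{v-1}_{k,ss}(k(C))$, the point $q(P)\in M(\rho)(k(C))$ extends uniquely to a morphism $\overline{q(P)}:C\to M(\rho)$, and $\mathrm{ht}_{GIT}(P):=\deg_C(\overline{q(P)}^*L)\in\mathbb{Q}$. Twisted bundle. If $E$ is defined by a cocycle $(h_{ij})$ with values in $GL_{e,k}$, $E^\rho$ is the vector bundle of rank $v$ defined by the cocycle $(\rho\circ h_{ij})$; a trivialization of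 $E_\eta$ induces one of $E^\rho_\eta$. The open subscheme $\mathbb{P}(E^\rho)_{ss}\subset\mathbb{P}(E^\rho)$ is the one whose fiber over each $x\in C(k)$ is the image of $\mathbb{P}^{v-1}_{k,ss}$ under the isomorphism $\mathbb{P}^{v-1}_k\simeq\mathbb{P}(E^\rho_x)$ induced by any basis of $E_x$ (it is independent of the basis, since $\mathbb{P}^{v-1}_{k,ss}$ is $GL_{e,k}$-stable). Height of sections. A point $P\in\mathbb{P}^{v-1}(k(C))\simeq\mathbb{P}(E^\rho_\eta)(k(C))$ extends uniquely to a section $\overline{P}:C\to\mathbb{P}(E^\rho)$, and $\mathrm{ht}_{\mathbb{P}(E^\rho)}(P):=\deg_C(\overline{P}^*\mathcal{O}_{E^\rho}(1))+\gamma\,\mu(E)$ (note $\mu(E^\rho)=\gamma\mu(E)$). *)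

(* Defs.v *)
From HB Require Import structures.
From mathcomp Require Import all_boot all_order all_algebra.
From mathcomp Require Import boolp classical_sets fsbigop.
From mathcomp Require Import mpoly.

Set Implicit Arguments.
Unset Strict Implicit.
Unset Printing Implicit Defensive.

Import Order.TTheory GRing.Theory Num.Theory.
Local Open Scope classical_set_scope.
Local Open Scope ring_scope.

(* All varieties below live over an algebraically closed field k.  An integral
   variety is handled through its k-points, its function field K, and the
   local rings of its points seen inside K; k is infinite, so polynomials with
   coefficients in k may be identified with functions on k-points. *)

(* F-points of P^(v-1) = P(k^v) = Proj S(k^v)^dual, for a field F over k:
   lines of F^v. *)
Definition pspace (F : fieldType) (v : nat) : Type :=
  {l : {vspace 'cV[F]_v} | \dim l == 1%N}.
HB.instance Definition _ (F : fieldType) (v : nat) :=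
  Choice.on (pspace F v).

(* A vector of homogeneous coordinates. *)
Definition hvec (F : fieldType) (v : nat) (P : pspace F v) : 'cV[F]_v :=
  vpick (val P).

Definition evf (k F : fieldType) (io : {rmorphism k -> F}) (v : nat)
    (f : {mpoly k[v]}) (w : 'cV[F]_v) : F :=
  mmap io (fun i => w i 0) f.

Definition evk (k : fieldType) (v : nat) (f : {mpoly k[v]}) (w : 'cV[k]_v) : k :=
  f.@[fun i => w i 0].

(* An integral closed subvariety of P^N over k, given by its generic point:
   it is the closure of a point [genpt] of P^N with values in [ffield], whose
   residue field is [ffield], i.e. [ffield] is the function field. *)
Record projvar (k : closedFieldType) := Projvar {
  amb : nat;
  ffield : fieldType;
  femb : {rmorphism k -> ffield};
  genpt : pspace ffield amb.+1;
  ffieldE : forall a : ffield, exists d (F G : {mpoly k[amb.+1]}),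
    [/\ F \is d.-homog, G \is d.-homog, evf femb G (hvec genpt) != 0 &
        a = evf femb F (hvec genpt) / evf femb G (hvec genpt)] }.

Section Varieties.
Variables (k : closedFieldType) (C : projvar k).
Local Notation K := (ffield C).
Local Notation N1 := (amb C).+1.

(* k-points, i.e. closed points. *)
Definition kpts : set (pspace k N1) := [set x |
  forall d (F : {mpoly k[N1]}), F \is d.-homog ->
    evf (femb C) F (hvec (genpt C)) = 0 -> evk F (hvec x) = 0].

(* [regval x a c]: the rational function a is regular at x and a(x) = c. *)
Definition regval (x : pspace k N1) (a : K) (c : k) : Prop :=
  exists d (F G : {mpoly k[N1]}),
    [/\ F \is d.-homog, G \is d.-homog, evk G (hvec x) != 0,
        a = evf (femb C) F (hvec (genpt C)) / evf (femb C) G (hvec (genpt C)) &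
        c = evk F (hvec x) / evk G (hvec x)].

Definition locring (x : pspace k N1) : set K := [set a | exists c, regval x a c].
Definition maxideal (x : pspace k N1) : set K := [set a | regval x a 0].

Definition zopen (U : set (pspace k N1)) : Prop :=
  exists S : set {mpoly k[N1]},
    (forall F, S F -> exists d, F \is d.-homog) /\
    U = [set x | kpts x /\ exists2 F, S F & evk F (hvec x) != 0].

Definition alg_indep n (a : 'I_n -> K) : Prop :=
  forall Q : {mpoly k[n]}, mmap (femb C) a Q = 0 -> Q = 0.

Definition has_dim n : Prop :=
  (exists a : 'I_n -> K, alg_indep a) /\
  (forall a : 'I_n.+1 -> K, ~ alg_indep a).

Definition uniformizer (x : pspace k N1) (pi : K) : Prop :=
  maxideal x pi /\
  forall a, maxideal x a -> exists2 b, locring x b & a = pi * b.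

(* Order at x of a nonzero rational function on a smooth curve. *)
Definition ord (x : pspace k N1) (a : K) : int :=
  xget 0 [set m : int | exists pi u c,
    [/\ uniformizer x pi, regval x u c, c != 0 & a = pi ^ m * u]].

End Varieties.
Arguments kpts {k} C.
Arguments regval {k} C x a c.
Arguments locring {k} C x.
Arguments maxideal {k} C x.
Arguments zopen {k} C U.
Arguments has_dim {k} C n.
Arguments uniformizer {k} C x pi.
Arguments ord {k} C x a.

(* Connected smooth projective curves.  Such a curve is integral; over the
   algebraically closed field k, smooth means that the local rings at closed
   points, here of dimension 1, are regular. *)
Record curve (k : closedFieldType) := Curve {
  cvar :> projvar k;
  curve_dim : has_dim cvar 1;
  curve_smooth : forall x, kpts cvar x -> exists pi, uniformizer cvar x pi }.

(* Cocycle data on an open cover.  A section s over U has coordinates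
   s_i on U_i, subject to s_i = (ctrans i j) s_j. *)
Record cocycle (k : closedFieldType) (C : curve k) (r : nat) := Cocycle {
  cidx : Type;
  copen : cidx -> set (pspace k (amb C).+1);
  ctrans : cidx -> cidx -> 'M[ffield C]_r }.

Section Bundles.
Variables (k : closedFieldType) (C : curve k).
Local Notation K := (ffield C).
Local Notation N1 := (amb C).+1.

(* Since C is irreducible, regular functions on a nonempty open set are the
   rational functions regular at each of its points, and nonempty open sets
   meet, so cocycle identities can be stated in K. *)
Definition vbundle r (E : cocycle C r) : Prop :=
  [/\ forall i : cidx E, zopen C (copen i) /\ copen i !=set0,
      forall x, kpts C x -> exists i : cidx E, copen i x,
      forall (i j : cidx E) x, copen i x -> copen j x ->
        forall a b, locring C x (ctrans i j a b),
      forall i : cidx E, ctrans i i = 1%:M &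
      forall i j l : cidx E, ctrans i j *m ctrans j l = ctrans i l].

(* A trivialization K^r ~ E_eta of the generic fiber; [tau i] gives the
   coordinates over U_i. *)
Definition gtriv r (E : cocycle C r) (tau : cidx E -> 'M[K]_r) : Prop :=
  (forall i, tau i \in unitmx) /\ (forall i j, tau i = ctrans i j *m tau j).

(* Nonzero rational sections of det E. *)
Definition detsec r (E : cocycle C r) (s : cidx E -> K) : Prop :=
  (forall i, s i != 0) /\ (forall i j, s i = \det (ctrans i j) * s j).

Definition secord r (E : cocycle C r) (s : cidx E -> K) (x : pspace k N1) : int :=
  xget 0 [set m : int | exists2 i, copen i x & m = ord C x (s i)].

(* deg E = deg (det E), the degree of the divisor of a nonzero rational
   section. *)
Definition deg r (E : cocycle C r) : int :=
  xget 0 [set m : int |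
    exists2 s : cidx E -> K, detsec s & m = \sum_(x \in kpts C) secord s x].

Definition slope r (E : cocycle C r) : rat := (deg E)%:~R / r%:R.

(* [specializes x w q]: the morphism Spec K -> P^(v-1) with homogeneous
   coordinates w extends to Spec O_{C,x}, and its value at x is q. *)
Definition specializes v (x : pspace k N1) (w : 'cV[K]_v) (q : pspace k v) : Prop :=
  exists2 c : K, c != 0 & forall j, regval C x (c * w j 0) (hvec q j 0).

End Bundles.
Arguments vbundle {k C r} E.
Arguments gtriv {k C r} E tau.
Arguments detsec {k C r} E s.
Arguments secord {k C r} E s x.
Arguments deg {k C r} E.
Arguments slope {k C r} E.
Arguments specializes {k C v} x w q.

(* Morphisms of algebraic groups GL_e -> GL_v: the matrix entries are the
   elements rnum / det^rexp of k[GL_e]. *)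
Record glmorph (k : closedFieldType) (e v : nat) := Glmorph {
  rnum : 'M[{mpoly k[e * e]}]_v;
  rexp : nat;
  rapp (F : fieldType) (io : {rmorphism k -> F}) (g : 'M[F]_e) : 'M[F]_v :=
    \matrix_(a, b) (mmap io (mxvec g 0) (rnum a b) / \det g ^+ rexp);
  rapp_unit : forall g : 'M[k]_e, g \in unitmx -> rapp idfun g \in unitmx;
  rappM : forall g h : 'M[k]_e, g \in unitmx -> h \in unitmx ->
    rapp idfun (g *m h) = rapp idfun g *m rapp idfun h }.

Section GIT.
Variables (k : closedFieldType) (e v : nat) (rho : glmorph k e v).

Definition homog_weight (gamma : int) : Prop :=
  forall t : k, t != 0 -> rapp rho idfun t%:M = (t ^ gamma)%:M.

Definition act (g : 'M[k]_e) (f : {mpoly k[v]}) : {mpoly k[v]} :=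
  f \mPo [tuple \sum_j (rapp rho idfun g i j) *: 'X_j | i < v].

(* The degree d part of the ring of SL_e-invariants. *)
Definition ginv (d : nat) : set {mpoly k[v]} :=
  [set f | f \is d.-homog /\ forall g : 'M[k]_e, \det g = 1 -> act g f = f].

(* F-points of the semistable locus. *)
Definition semistable (F : fieldType) (io : {rmorphism k -> F}) : set (pspace F v) :=
  [set P | exists d f, [/\ (0 < d)%N, ginv d f & evf io f (hvec P) != 0]].

(* M(rho) = Proj A, with A the ring of invariants, is projective and carries an
   ample Q-line bundle L pulling back to O(1).  It is presented here as the
   d-th root of the very ample line bundle O(d) on Proj A, where d is such that
   the Veronese ring A^(d) is generated by its degree one part A_d; such d
   exist because A is a finitely generated algebra. *)
Record gitpol := Gitpol {
  pdeg : nat;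
  pdeg_gt0 : (0 < pdeg)%N;
  pdeg_gen : forall r f, (0 < r)%N -> ginv (r * pdeg) f ->
    exists s : seq (r.-tuple {mpoly k[v]}),
      (forall t, t \in s -> forall i, ginv pdeg (tnth t i)) /\
      f = \sum_(t <- s) \prod_(i < r) tnth t i }.

End GIT.

Section Heights.
Variables (k : closedFieldType) (C : curve k) (e v : nat) (rho : glmorph k e v).
Local Notation K := (ffield C).
Local Notation N1 := (amb C).+1.
Implicit Type P : pspace K v.

(* The points x of C mapped into D_+(f), for f in A_d, by the extension
   C -> M(rho) of q(P): those for which the morphism of k-algebras
   A_(f) -> K, a / f^r |-> a(P) / f(P)^r, takes values in O_{C,x}. *)
Definition qbar_chart (d : nat) P (f : {mpoly k[v]}) : set (pspace k N1) :=
  [set x | kpts C x /\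
    forall r a, ginv rho (r * d) a ->
      locring C x (evf (femb C) a (hvec P) / evf (femb C) f (hvec P) ^+ r)].

(* The pull-back of O(d) = L^d along this extension; on D_+(f) the line
   bundle O(d) is trivialized by f. *)
Definition qbar_O (d : nat) P : cocycle C 1 :=
  @Cocycle k C 1
    {f : {mpoly k[v]} | ginv rho d f /\ evf (femb C) f (hvec P) != 0}
    (fun f => qbar_chart d P (sval f))
    (fun f g => (evf (femb C) (sval g) (hvec P) / evf (femb C) (sval f) (hvec P))%:M).

Definition ht_GIT (L : gitpol rho) P : rat :=
  (deg (qbar_O (pdeg L) P))%:~R / (pdeg L)%:R.

Variables (E : cocycle C e) (tau : cidx E -> 'M[K]_e).

Definition assoc_bundle : cocycle C v :=
  @Cocycle k C v (cidx E) (@copen k C e E)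
    (fun i j => rapp rho (femb C) (ctrans i j)).

Definition assoc_triv : cidx assoc_bundle -> 'M[K]_v :=
  fun i => rapp rho (femb C) (tau i).

(* Homogeneous coordinates of P, seen as a point of P(E^rho_eta), in the chart
   of E^rho over U_i. *)
Definition chart_vec P (i : cidx assoc_bundle) : 'cV[K]_v :=
  assoc_triv i *m hvec P.

(* q is the value at x of the section of P(E^rho) extending P, in the
   identification of the fiber at x with P^(v-1) given by the chart i. *)
Definition Pbar P (i : cidx assoc_bundle) (x : pspace k N1) (q : pspace k v) : Prop :=
  [/\ kpts C x, copen i x & specializes x (chart_vec P i) q].

(* The pull-back of O_{E^rho}(1) along this section.  Over the chart i, on the
   locus where the coordinate X_j does not vanish, O(1) is trivialized by X_j;
   the index set consists of the (i, j) for which this locus is nonempty. *)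
Definition Pbar_O1 P : cocycle C 1 :=
  @Cocycle k C 1
    {ij : cidx assoc_bundle * 'I_v | chart_vec P ij.1 ij.2 0 != 0}
    (fun a => [set x | exists2 q, Pbar P (sval a).1 x q & hvec q (sval a).2 0 != 0])
    (fun a b => (chart_vec P (sval b).1 (sval b).2 0
                 / chart_vec P (sval a).1 (sval a).2 0)%:M).

Definition ht_PE (gamma : int) P : rat :=
  (deg (Pbar_O1 P))%:~R + gamma%:~R * slope E.

Definition Pbar_semistable P : Prop :=
  forall (i : cidx assoc_bundle) x, kpts C x -> copen i x ->
    exists2 q, Pbar P i x q & semistable rho idfun q.

End Heights.

(* Main.v *)
(* Let w be homogeneous coordinates of P.  Since rho is homogeneous of weight
   gamma, an invariant f of degree d satisfies
   f(rho(g) w)^e = det(g)^(gamma d) f(w)^e for every g in GL_e.  Apply this to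
   the trivialization g = tau_i near a closed point x of C: the order at x of
   f(rho(g) w) is at least d times the minimal order of the coordinates of
   rho(g) w, with equality iff f does not vanish at the value of Pbar at x.
   Minimizing over f in A_d yields an inequality between the local
   contributions at x of the three line bundles (pull-back of L, pull-back of
   O(1), det E), which is an equality iff Pbar(x) is semistable.  The theorem
   is the sum of these inequalities over x.

   The degree of a line bundle does not depend on the rational section by the
   product formula on C.  If a function a had n zeros and m < n poles, the
   products u_l a^s, with s <= r and u_1, ..., u_n having suitable leading terms
   at the zeros of a, would be n(r+1) linearly independent elements of a
   Riemann-Roch space of dimension at most rm + O(1).  The bound on this
   dimension uses that functions regular everywhere are constant, that is, that
   every place of the function field has a center on C. *)

Require Import Defs.
From mathcomp Require Import all_boot all_order all_algebra.
From mathcomp Require Import boolp classical_sets fsbigop.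
From mathcomp Require Import mpoly zify ring.

Set Implicit Arguments.
Unset Strict Implicit.
Unset Printing Implicit Defensive.

Import Order.TTheory GRing.Theory Num.Theory.
Local Open Scope ring_scope.

(** * Homogeneous coordinates *)

Section ProjectiveSpace.
Variables (F : fieldType) (v : nat).
Implicit Types P Q : pspace F v.

Lemma hvec_neq0 P : hvec P != 0.
Proof. by rewrite /hvec vpick0 -dimv_eq0 (eqP (valP P)). Qed.

Lemma hvec_coord P : exists i, hvec P i 0 != 0.
Proof. exact/cV0Pn/hvec_neq0. Qed.

Lemma pspace_line P : val P = <[hvec P]>%VS.
Proof.
apply/eqP; rewrite eq_sym eqEdim (eqP (valP P)) dim_vline hvec_neq0 andbT.
by rewrite -memvE memv_pick.
Qed.

Lemma hvec_surj (u : 'cV[F]_v) : u != 0 ->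
  exists P, exists2 c, c != 0 & hvec P = c *: u.
Proof.
move=> u0; have du : \dim <[u]>%VS == 1%N by rewrite dim_vline u0.
pose P : pspace F v := exist _ <[u]>%VS du; exists P.
have /vlineP [c hc] : hvec P \in <[u]>%VS by exact: memv_pick.
by exists c => //; apply: contraNneq (hvec_neq0 P) => c0; rewrite hc c0 scale0r.
Qed.

Lemma hvec_inj P Q c : hvec P = c *: hvec Q -> P = Q.
Proof.
move=> h; apply: val_inj; rewrite /= !pspace_line; apply/eqP.
by rewrite eqEdim !dim_vline !hvec_neq0 -memvE h memvZ ?memv_line.
Qed.

End ProjectiveSpace.

Lemma evf_homogZ (k F : fieldType) (io : {rmorphism k -> F}) v d
    (f : {mpoly k[v]}) c (w : 'cV[F]_v) :
  f \is d.-homog -> evf io f (c *: w) = c ^+ d * evf io f w.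
Proof.
move=> /dhomogP hf; rewrite /evf /mmap mulr_sumr; apply: eq_big_seq => m hm.
rewrite mulrCA; congr (_ * _); have <- : mdeg m = d := hf _ hm.
rewrite /mmap1 mdegE -prodrXr -big_split.
by apply: eq_bigr => i _; rewrite mxE exprMn.
Qed.

Lemma evk_homogZ (k : fieldType) v d (f : {mpoly k[v]}) c (w : 'cV[k]_v) :
  f \is d.-homog -> evk f (c *: w) = c ^+ d * evk f w.
Proof. exact: (evf_homogZ idfun). Qed.

(** * Extension of places *)

Section PartialHom.
Variables (k K : fieldType) (io : {rmorphism k -> K}).

(* A homomorphism to k from a k-subalgebra of K, given by its graph. *)
Record phom (Phi : K -> k -> Prop) : Prop := Phom {
  phomC : forall c, Phi (io c) c;
  phomD : forall a b c d, Phi a c -> Phi b d -> Phi (a + b) (c + d);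
  phomM : forall a b c d, Phi a c -> Phi b d -> Phi (a * b) (c * d);
  phom0 : forall c, Phi 0 c -> c = 0 }.

Variable Phi : K -> k -> Prop.
Hypothesis hPhi : phom Phi.

Lemma phom_zero : Phi 0 0.
Proof. by have := phomC hPhi 0; rewrite rmorph0. Qed.

Lemma phom_one : Phi 1 1.
Proof. by have := phomC hPhi 1; rewrite rmorph1. Qed.

Lemma phomN a c : Phi a c -> Phi (- a) (- c).
Proof.
move=> h; have := phomM hPhi (phomC hPhi (-1)) h.
by rewrite rmorphN1 !mulN1r.
Qed.

Lemma phomB a b c d : Phi a c -> Phi b d -> Phi (a - b) (c - d).
Proof. by move=> h h'; apply: (phomD hPhi) => //; apply: phomN. Qed.

Lemma phom_uniq a c d : Phi a c -> Phi a d -> c = d.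
Proof.
move=> h h'; apply/eqP; rewrite -subr_eq0; apply/eqP; apply: (phom0 hPhi).
by rewrite -(subrr a); apply: phomB.
Qed.

Lemma phomX a c n : Phi a c -> Phi (a ^+ n) (c ^+ n).
Proof.
move=> h; elim: n => [|n IH]; first exact: phom_one.
by rewrite !exprS; apply: (phomM hPhi).
Qed.

Lemma phom_sum I (r : seq I) (P : pred I) (f : I -> K) (g : I -> k) :
  (forall i, P i -> Phi (f i) (g i)) ->
  Phi (\sum_(i <- r | P i) f i) (\sum_(i <- r | P i) g i).
Proof.
move=> h; apply: (big_ind2 Phi) => //; first exact: phom_zero.
by move=> *; apply: (phomD hPhi).
Qed.

Lemma phom_prod I (r : seq I) (P : pred I) (f : I -> K) (g : I -> k) :
  (forall i, P i -> Phi (f i) (g i)) ->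
  Phi (\prod_(i <- r | P i) f i) (\prod_(i <- r | P i) g i).
Proof.
move=> h; apply: (big_ind2 Phi) => //; first exact: phom_one.
by move=> *; apply: (phomM hPhi).
Qed.

Lemma phom_mmap n (f : {mpoly k[n]}) (a : 'I_n -> K) (c : 'I_n -> k) :
  (forall i, Phi (a i) (c i)) -> Phi (mmap io a f) f.@[c].
Proof.
move=> h; rewrite /meval /mmap; apply: phom_sum => m _.
apply: (phomM hPhi); first exact: phomC.
by apply: phom_prod => i _; apply: phomX.
Qed.

Lemma phom_evf v (f : {mpoly k[v]}) (w : 'cV[K]_v) (w' : 'cV[k]_v) :
  (forall j, Phi (w j 0) (w' j 0)) -> Phi (evf io f w) (evk f w').
Proof. by move=> h; apply: phom_mmap. Qed.

Lemma phom_det n (A : 'M[K]_n) (B : 'M[k]_n) :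
  (forall i j, Phi (A i j) (B i j)) -> Phi (\det A) (\det B).
Proof.
move=> h; rewrite /determinant; apply: phom_sum => s _.
apply: (phomM hPhi); last by apply: phom_prod.
by apply: phomX; apply: phomN; apply: phom_one.
Qed.

Lemma phom_horner (p : {poly K}) (q : {poly k}) a c :
  (forall i, Phi p`_i q`_i) -> Phi a c -> Phi p.[a] q.[c].
Proof.
move=> h ha; set n := maxn (size p) (size q).
rewrite (horner_coef_wide _ (leq_maxl _ _ : size p <= n)%N).
rewrite (horner_coef_wide _ (leq_maxr _ _ : size q <= n)%N).
by apply: phom_sum => i _; apply: (phomM hPhi) => //; apply: phomX.
Qed.

Lemma phom_map_poly (q : {poly k}) a c : Phi a c -> Phi (map_poly io q).[a] q.[c].
Proof. by apply: phom_horner => i; rewrite coef_map; apply: phomC. Qed.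

End PartialHom.

Section Places.
Variables (k : closedFieldType) (K : fieldType) (io : {rmorphism k -> K}).

(** Division with remainder shows that a nonzero element of least degree divides every member of the
    ideal [J]. It is not constant because [J] is proper, so it has a root in the algebraically
    closed field [k]. *)
Lemma ideal_common_root (J : {poly k} -> Prop) :
  (forall p q, J p -> J q -> J (p + q)) -> (forall p q, J q -> J (p * q)) ->
  (forall c, J c%:P -> c = 0) -> exists t, forall q, J q -> q.[t] = 0.
Proof.
move=> JD JM J1.
have [[q [Jq q0]]|] := pselect (exists q, J q /\ q != 0); last first.
  move=> h; exists 0 => q Jq; case: (eqVneq q 0) => [->|q0]; first by rewrite horner0.
  by case: h; exists q.
have ex : exists n, `[< exists q, [/\ J q, q != 0 & size q = n] >].
  by exists (size q); apply/asboolP; exists q.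
case: (ex_minnP ex) => n /asboolP [p [Jp p0 sp]] nmin.
have sp1 : size p != 1%N.
  apply/negP => /size_poly1P [c c0 pc]; move: Jp; rewrite pc => /J1 /eqP.
  by rewrite (negPf c0).
have /closed_rootP [t /rootP pt] := sp1; exists t => r Jr.
suff : r %% p = 0.
  move=> r0; have := divp_eq r p; rewrite r0 addr0 => ->.
  by rewrite hornerM pt mulr0.
apply: contraTeq (ltn_modpN0 r p0) => m0; rewrite -leqNgt sp; apply: nmin.
apply/asboolP; exists (r %% p); split=> //.
have -> : r %% p = r + (- (r %/ p)) * p by rewrite {2}(divp_eq r p) mulNr addrC addKr.
by apply: JD => //; apply: JM.
Qed.

(* The ideal generated by the kernel of Phi cannot be the unit ideal both in
   A[z] and in A[1/z]: [bad] says that it is in A[z], after clearing a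
   denominator on which Phi does not vanish. *)
Let bad (Phi : K -> k -> Prop) z (p : {poly K}) (c : k) :=
  [/\ forall i, Phi p`_i (c *+ (i == 0)%N), p.[z] = 0 & c != 0].

(** Chevalley's argument, by induction on the sum of the two degrees. Exchanging [z] and its
    inverse, [p] may be taken of the larger degree; its leading term is then eliminated with the
    help of [p']. *)
Lemma not_both_bad Phi (hPhi : phom io Phi) (z : K) p c p' c' :
  z != 0 -> bad Phi z p c -> bad Phi z^-1 p' c' -> False.
Proof.
have [N] := ubnP (size p + size p'); elim: N => // N IH in z p c p' c' *.
wlog szp : z p c p' c' / (size p' <= size p)%N => [hw|].
  move=> sz z0 b b'; have [le|/ltnW le] := leqP (size p') (size p).
    exact: (hw z p c p' c').
  apply: (hw z^-1 p' c' p c le _ _ b') => //; rewrite ?invr_eq0 ?invrK //.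
  by rewrite addnC.
rewrite ltnS => sz z0 [hp pz c0] [hp' pz' c0'].
have p0 : p != 0.
  apply: contra_neq c0 => p0; apply: (phom0 hPhi).
  by have := hp 0%N; rewrite p0 coef0.
case sp : (size p) => [|n]; first by move/eqP: sp; rewrite size_poly_eq0 (negPf p0).
have n0 : n != 0%N.
  apply/eqP => n0; rewrite n0 in sp.
  have [d _ pd] : exists2 d, d != 0 & p = d%:P by apply/size_poly1P/eqP.
  move: pz; rewrite pd hornerC => d0; move: (hp 0%N); rewrite pd d0 coefC /=.
  by move=> /(phom0 hPhi)/eqP; rewrite (negPf c0).
(* This is p'_0 p(z) - p_n z^n p'(1/z): the terms in z^n cancel. Since p_n has value 0, the constant
   coefficient keeps the nonzero value [c' * c] and the others keep the value 0. *)
pose R := \poly_(i < n) (p'`_0 * p`_i - p`_n * p'`_(n - i)).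
apply: (IH z R (c' * c) p' c') => //; last split=> //.
- by apply: leq_trans sz; rewrite ltn_add2r sp ltnS size_poly.
- move=> i; rewrite coef_poly; case: ltnP => [lin|leni]; last first.
    by rewrite (_ : (i == 0)%N = false) ?mulr0n; [apply: phom_zero hPhi|lia].
  have -> : c' * c *+ (i == 0)%N = c' * (c *+ (i == 0)%N) - 0 * (c' *+ (n - i == 0)%N).
    by rewrite mul0r subr0 mulrnAr.
  apply: (phomB hPhi); apply: (phomM hPhi) => //.
  by have := hp n; rewrite (negPf n0) mulr0n.
- rewrite (horner_coef_wide _ (size_poly _ _)).
  rewrite (eq_bigr (fun i : 'I_n => (p'`_0 * p`_i - p`_n * p'`_(n - i)) * z ^+ i)); last first.
    by move=> i _; rewrite coef_poly ltn_ord.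
  transitivity (\sum_(i < n.+1) (p'`_0 * p`_i - p`_n * p'`_(n - i)) * z ^+ i).
    by rewrite big_ord_recr /= subnn [p`_n * _]mulrC subrr mul0r addr0.
  transitivity (p'`_0 * p.[z] - p`_n * (z ^+ n * p'.[z^-1])); last first.
    by rewrite pz pz' !mulr0 subr0.
  have szp' : (size p' <= n.+1)%N by rewrite -sp.
  rewrite (horner_coef_wide _ szp') horner_coef sp !mulr_sumr.
  rewrite [X in _ - X](reindex_inj rev_ord_inj) /= -sumrB; apply: eq_bigr => i _.
  rewrite subSS mulrBl !mulrA; congr (_ - _).
  rewrite -!mulrA; congr (_ * _); rewrite mulrCA; congr (_ * _).
  have lin : (i <= n)%N by rewrite -ltnS.
  by rewrite exprVn -exprB ?leq_subr ?unitfE // subKn.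
- by rewrite mulf_neq0.
Qed.

(** The reductions to k[X] of the polynomials over the domain of [Phi] that vanish at [z] form an
    ideal. The hypothesis says that this ideal is proper, and [z] can be sent to any common root of
    its members. *)
Lemma phom_adjoin (Phi : K -> k -> Prop) (hPhi : phom io Phi) (z : K) :
  (forall p c, ~ bad Phi z p c) ->
  exists Phi' t, [/\ phom io Phi', forall a c, Phi a c -> Phi' a c & Phi' z t].
Proof.
move=> nb; pose cf (p : {poly K}) (q : {poly k}) := forall i, Phi p`_i q`_i.
have cfM p q p' q' : cf p q -> cf p' q' -> cf (p * p') (q * q').
  move=> h h' i; rewrite !coefM; apply: (phom_sum hPhi) => j _.
  exact: (phomM hPhi).
have cfD p q p' q' : cf p q -> cf p' q' -> cf (p + p') (q + q').
  by move=> h h' i; rewrite !coefD; apply: (phomD hPhi).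
have cfC a c : Phi a c -> cf a%:P c%:P.
  by move=> h i; rewrite !coefC; case: eqP => // _; apply: phom_zero hPhi.
have [|||t ht] := @ideal_common_root (fun q => exists2 p, cf p q & p.[z] = 0).
- move=> q q' [p h pz] [p' h' pz']; exists (p + p'); first exact: cfD.
  by rewrite hornerD pz pz' addr0.
- move=> q q' [p' h' pz']; exists (map_poly io q * p').
    by apply: cfM => // i; rewrite coef_map; apply: (phomC hPhi).
  by rewrite hornerM pz' mulr0.
- move=> c [p h pz]; apply/eqP/negPn/negP => c0; apply: (nb p c); split=> // i.
  by have := h i; rewrite coefC; case: eqP.
exists (fun a c => exists p q, [/\ cf p q, a = p.[z] & c = q.[t]]), t; split.
- split.
  + move=> c; exists (io c)%:P, c%:P; rewrite !hornerC; split=> //.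
    by apply: cfC; apply: (phomC hPhi).
  + move=> a b c d [p [q [h -> ->]]] [p' [q' [h' -> ->]]].
    by exists (p + p'), (q + q'); rewrite !hornerD; split=> //; apply: cfD.
  + move=> a b c d [p [q [h -> ->]]] [p' [q' [h' -> ->]]].
    by exists (p * p'), (q * q'); rewrite !hornerM; split=> //; apply: cfM.
  + by move=> c [p [q [h pz ->]]]; apply: ht; exists p.
- by move=> a c h; exists a%:P, c%:P; rewrite !hornerC; split=> //; apply: cfC.
- exists 'X, 'X; rewrite !hornerX; split=> // i; rewrite !coefX.
  by case: eqP => _; [apply: phom_one hPhi|apply: phom_zero hPhi].
Qed.

(** By [not_both_bad], every nonzero [z] of the list, or else its inverse, satisfies the hypothesis
    of [phom_adjoin]; the list is treated one element at a time. *)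
Lemma phom_extend (s : seq K) (Phi : K -> k -> Prop) : phom io Phi ->
  exists Phi', [/\ phom io Phi', forall a c, Phi a c -> Phi' a c &
    forall z, z \in s -> z != 0 -> exists t, Phi' z t \/ Phi' z^-1 t].
Proof.
elim: s Phi => [|z s IH] Phi hPhi; first by exists Phi.
have [Phi1 [h1 s1 z1]] : exists Phi1, [/\ phom io Phi1,
    forall a c, Phi a c -> Phi1 a c & z != 0 -> exists t, Phi1 z t \/ Phi1 z^-1 t].
  have [z0|z0] := eqVneq z 0; first by exists Phi.
  have [nb|nnb] := pselect (forall p c, ~ bad Phi z p c).
    by have [Phi1 [t [? ? ?]]] := phom_adjoin hPhi nb; exists Phi1; split=> // _; exists t; left.
  have [|Phi1 [t [? ? ?]]] := @phom_adjoin _ hPhi z^-1; last first.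
    by exists Phi1; split=> // _; exists t; right.
  move=> p' c' b'; apply: nnb => p c b; exact: (not_both_bad hPhi z0 b b').
have [Phi2 [h2 s2 z2]] := IH _ h1; exists Phi2; split=> //.
  by move=> a c /s1/s2.
move=> y; rewrite inE => /orP [/eqP ->|]; last exact: z2.
by move=> /z1 [t [/s2|/s2]] ?; exists t; [left|right].
Qed.

Lemma closed_algebraic (b : K) (p : {poly k}) : p != 0 -> (map_poly io p).[b] = 0 ->
  exists c, b = io c.
Proof.
move=> p0; have [r ->] := closed_field_poly_normal p.
rewrite map_polyZ hornerZ => /eqP; rewrite mulf_eq0 fmorph_eq0 lead_coef_eq0 (negPf p0) /=.
rewrite rmorph_prod /= horner_prod prodf_seq_eq0 => /hasP [c _ /=].
by rewrite map_polyXsubC hornerXsubC subr_eq0 => /eqP bc; exists c.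
Qed.

(** A nonconstant [b] is transcendental over the algebraically closed field [k], so k[b] is a
    polynomial ring and evaluation at [t] is well defined on it. *)
Lemma phom_transcendental (b : K) t : (forall c, b <> io c) ->
  phom io (fun u c => exists p, u = (map_poly io p).[b] /\ c = p.[t]).
Proof.
move=> hb; split.
- by move=> c; exists c%:P; rewrite map_polyC !hornerC.
- by move=> _ _ _ _ [p [-> ->]] [q [-> ->]]; exists (p + q); rewrite rmorphD !hornerD.
- by move=> _ _ _ _ [p [-> ->]] [q [-> ->]]; exists (p * q); rewrite rmorphM !hornerM.
- move=> _ [p [p0 ->]]; have [->|pn0] := eqVneq p 0; first by rewrite horner0.
  by case: (closed_algebraic pn0 (esym p0)) => c /hb.
Qed.

End Places.

(** * Points of a projective variety *)

Section LocalRings.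
Variables (k : closedFieldType) (C : projvar k).
Local Notation K := (ffield C).
Local Notation N1 := (amb C).+1.
Local Notation io := (femb C).
Local Notation gen := (hvec (genpt C)).
Implicit Types (x : pspace k N1) (a b : K) (F G : {mpoly k[N1]}).

Lemma evf_neq0 x d F : kpts C x -> F \is d.-homog -> evk F (hvec x) != 0 ->
  evf io F gen != 0.
Proof. by move=> hx hF; apply: contra_neq; apply: hx hF. Qed.

Lemma evfM F G (w : 'cV[K]_N1) : evf io (F * G) w = evf io F w * evf io G w.
Proof. exact: rmorphM. Qed.

Lemma evkM F G (w : 'cV[k]_N1) : evk (F * G) w = evk F w * evk G w.
Proof. exact: rmorphM. Qed.

Lemma evfD F G (w : 'cV[K]_N1) : evf io (F + G) w = evf io F w + evf io G w.
Proof. exact: rmorphD. Qed.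

Lemma evkD F G (w : 'cV[k]_N1) : evk (F + G) w = evk F w + evk G w.
Proof. exact: rmorphD. Qed.

Lemma evfX i (w : 'cV[K]_N1) : evf io 'X_i w = w i 0.
Proof. by rewrite /evf mmapX mmap1U. Qed.

Lemma evkX i (w : 'cV[k]_N1) : evk 'X_i w = w i 0.
Proof. by rewrite /evk mevalXU. Qed.

Lemma evkXn F n (w : 'cV[k]_N1) : evk (F ^+ n) w = evk F w ^+ n.
Proof. exact: rmorphXn. Qed.

Lemma evfXn F n (w : 'cV[K]_N1) : evf io (F ^+ n) w = evf io F w ^+ n.
Proof. exact: rmorphXn. Qed.

Lemma dhomogXU i : ('X_i : {mpoly k[N1]}) \is 1.-homog.
Proof. by rewrite dhomogX; apply/eqP; apply: mdeg1. Qed.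

Lemma regval_ratio x d F G : F \is d.-homog -> G \is d.-homog ->
  evk G (hvec x) != 0 ->
  regval C x (evf io F gen / evf io G gen) (evk F (hvec x) / evk G (hvec x)).
Proof. by exists d, F, G. Qed.

Lemma regval_phom x : kpts C x -> phom io (regval C x).
Proof.
move=> hx; split.
- move=> c; exists 0%N, c%:MP, 1; split; rewrite ?dhomog1 //.
  + by rewrite -[c%:MP]mulr1 mul_mpolyC dhomogZ // dhomog1.
  + by rewrite /evk meval1 oner_eq0.
  + by rewrite /evf rmorph1 divr1 mmapC.
  + by rewrite /evk meval1 mevalC divr1.
- move=> _ _ _ _ [d [F [G [hF hG G0 -> ->]]]] [d' [F' [G' [hF' hG' G0' -> ->]]]].
  exists (d + d')%N, (F * G' + F' * G), (G * G').
  have h0 := evf_neq0 hx hG G0; have h0' := evf_neq0 hx hG' G0'; split.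
  + by rewrite rpredD ?(dhomogM hF hG') // addnC dhomogM.
  + exact: dhomogM.
  + by rewrite evkM mulf_neq0.
  + by rewrite evfD !evfM addf_div.
  + by rewrite evkD !evkM addf_div.
- move=> _ _ _ _ [d [F [G [hF hG G0 -> ->]]]] [d' [F' [G' [hF' hG' G0' -> ->]]]].
  exists (d + d')%N, (F * F'), (G * G'); split.
  + exact: dhomogM.
  + exact: dhomogM.
  + by rewrite evkM mulf_neq0.
  + by rewrite !evfM mulf_div.
  + by rewrite !evkM mulf_div.
- move=> _ [d [F [G [hF hG G0 /esym/eqP + ->]]]].
  rewrite mulf_eq0 invr_eq0 (negPf (evf_neq0 hx hG G0)) orbF => /eqP /(hx _ _ hF) ->.
  by rewrite mul0r.
Qed.

Lemma regvalV x a c : regval C x a c -> c != 0 -> regval C x a^-1 c^-1.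
Proof.
move=> [d [F [G [hF hG G0 -> ->]]]] c0; rewrite !invf_div; apply: (regval_ratio hG hF).
by apply: contra_neq c0 => ->; rewrite mul0r.
Qed.

Lemma frac_locring x a : kpts C x ->
  exists b d, [/\ locring C x b, locring C x d, d != 0 & a = b / d].
Proof.
move=> hx; have [d [F [G [hF hG G0 ->]]]] := ffieldE a.
have [i xi0] := hvec_coord x.
have hX : ('X_i ^+ d : {mpoly k[N1]}) \is d.-homog.
  by have := dhomogMn d (dhomogXU i); rewrite mul1n.
have X0 : evk ('X_i ^+ d) (hvec x) != 0 by rewrite evkXn evkX expf_neq0.
have hX0 := evf_neq0 hx hX X0.
exists (evf io F gen / evf io ('X_i ^+ d) gen), (evf io G gen / evf io ('X_i ^+ d) gen).
split; [by eexists; apply: regval_ratio hX X0|by eexists; apply: regval_ratio hX X0| |].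
- by rewrite mulf_neq0 ?invr_eq0.
- by rewrite invf_div mulrA divfK.
Qed.

(* The point x is the center of Phi on C.  The factor b makes the statement cover
   the functions a at which Phi takes the value infinity. *)
Lemma phom_center (Phi : K -> k -> Prop) : phom io Phi ->
  exists2 x, kpts C x & forall a b c d e,
    regval C x a c -> Phi b d -> Phi (a * b) e -> e = c * d.
Proof.
move=> hPhi.
pose s := [seq gen p.1 0 / gen p.2 0 | p : 'I_N1 * 'I_N1].
have [Psi [hPsi sub alt]] := phom_extend s hPhi.
have {}alt i j : gen i 0 / gen j 0 != 0 ->
    exists t, Psi (gen i 0 / gen j 0) t \/ Psi (gen j 0 / gen i 0) t.
  by move=> h; rewrite -[gen j 0 / _]invf_div; apply: alt => //; apply/codomP; exists (i, j).
have zero := phom_zero hPsi.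
(* [i0] plays the role of a coordinate of least order for the place. The coordinates are scanned,
   and [j] replaces [i0] when it is the ratio of coordinate [i0] to coordinate [j] that has a
   value. *)
have [i0 g0 dom] : exists2 i0, gen i0 0 != 0 & forall j, exists t, Psi (gen j 0 / gen i0 0) t.
  have /cV0Pn [j0 j00] := hvec_neq0 (genpt C).
  suff [i0 h hd] : exists2 i0, gen i0 0 != 0 &
      forall j, j \in j0 :: enum 'I_N1 -> exists t, Psi (gen j 0 / gen i0 0) t.
    by exists i0 => // j; apply: hd; rewrite inE mem_enum orbT.
  elim/last_ind: {s}(enum _) => [|s j [i0 i00 IH]].
    exists j0 => // j; rewrite inE => /eqP ->; rewrite divff //.
    by exists 1; apply: phom_one hPsi.
  have [gj|gj] := eqVneq (gen j 0) 0.
    exists i0 => // l; rewrite -rcons_cons mem_rcons inE => /orP [/eqP ->|]; last exact: IH.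
    by exists 0; rewrite gj mul0r.
  have [|t [ht|ht]] := alt j i0; first by rewrite mulf_neq0 ?invr_eq0.
    exists i0 => // l; rewrite -rcons_cons mem_rcons inE => /orP [/eqP ->|]; last exact: IH.
    by exists t.
  exists j => // l; rewrite -rcons_cons mem_rcons inE => /orP [/eqP ->|/IH [t' ht']].
    by rewrite divff //; exists 1; apply: phom_one hPsi.
  by exists (t' * t); rewrite -[X in X / gen j 0](divfK i00) -mulrA; apply: (phomM hPsi).
have [xi hxi] := choice dom.
(* The values of the ratios to coordinate [i0] are homogeneous coordinates of the center. *)
pose u : 'cV[k]_N1 := \col_j xi j.
have ui0 : u i0 0 = 1.
  by rewrite mxE; apply: (phom_uniq hPsi (hxi _)); rewrite divff //; apply: phom_one hPsi.
have u0 : u != 0 by apply/cV0Pn; exists i0; rewrite ui0 oner_eq0.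
have [x [l l0 hx]] := hvec_surj u0.
have ev F : Psi (evf io F ((gen i0 0)^-1 *: gen)) (evk F u).
  by apply: (phom_evf hPsi) => j; rewrite !mxE mulrC.
exists x.
  move=> d F hF F0; rewrite hx (evk_homogZ _ _ hF).
  suff -> : evk F u = 0 by rewrite mulr0.
  by apply: (phom0 hPsi); have := ev F; rewrite (evf_homogZ _ _ _ hF) F0 mulr0.
move=> a b _ c e [d [F [G [hF hG G0 aE ->]]]] /sub bc /sub abe.
rewrite hx !(evk_homogZ _ _ hF, evk_homogZ _ _ hG) in G0 *.
move: G0; rewrite mulf_eq0 negb_or => /andP [ld0 Gu0].
rewrite -mulf_div divff // mul1r mulrAC; apply: canRL (mulfK Gu0) _.
have Gg0 : evf io G ((gen i0 0)^-1 *: gen) != 0.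
  apply: contra_neq Gu0 => G0'; apply: (phom0 hPsi); rewrite -G0'; exact: ev.
have aE' : a * b * evf io G ((gen i0 0)^-1 *: gen) =
           evf io F ((gen i0 0)^-1 *: gen) * b.
  move: Gg0; rewrite aE !(evf_homogZ _ _ _ hF, evf_homogZ _ _ _ hG) mulf_eq0 negb_or.
  by move=> /andP [_ Gg]; field.
apply: (phom_uniq hPsi _ (phomM hPsi (ev F) bc)).
by rewrite -aE'; apply: (phomM hPsi).
Qed.

(** If [a] is not constant, some place sends its inverse to 0. Were [a] regular with value [c] at
    the center of this place, 1 would have the value [c * 0]. *)
Lemma regular_everywhere_const a : (forall x, kpts C x -> locring C x a) ->
  exists c, a = io c.
Proof.
move=> ha; apply: contrapT => na.
have a0 : a != 0 by apply/eqP => a0; apply: na; exists 0; rewrite rmorph0.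
have hb c : a^-1 <> io c.
  by move=> h; apply: na; exists c^-1; rewrite fmorphV -h invrK.
have hPhi := phom_transcendental 0 hb.
have [x hx hc] := phom_center hPhi; have [c hac] := ha x hx.
suff /eqP : (1 : k) = c * 0 by rewrite mulr0 oner_eq0.
apply: (hc _ a^-1 _ _ _ hac).
  by exists 'X; rewrite map_polyX !hornerX.
by exists 1; rewrite rmorph1 !hornerC divff.
Qed.

End LocalRings.

(** * Consequences of transcendence degree one *)

Section AlgebraicDependence.
Variables (k K : fieldType) (io : {rmorphism k -> K}).

Definition horner2 (Q : {poly {poly k}}) (b a : K) : K :=
  (map_poly (horner_eval b \o map_poly io) Q).[a].

Definition mpoly2_poly (Q : {mpoly k[2]}) : {poly {poly k}} :=
  mmap (polyC \o polyC) (fun i : 'I_2 => if i == 0 then 'X else 'X%:P) Q.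

Lemma mpoly2_polyE Q : mpoly2_poly Q =
  \sum_(m <- msupp Q) (Q@_m *: 'X^(m 1%R))%:P * 'X^(m 0%R).
Proof.
apply: eq_bigr => m _; rewrite /mmap1 big_ord_recl big_ord1 /=.
have -> : lift ord0 ord0 = 1 :> 'I_2 by apply: val_inj.
rewrite mulrCA mulrC -rmorphXn -rmorphM /= [(Q@_m)%:P * _]mul_polyC.
by congr (_ * 'X^(m _)); apply: val_inj.
Qed.

Lemma coef_mpoly2_poly Q (m : 'X_{1..2}) : (mpoly2_poly Q)`_(m 0%R)`_(m 1%R) = Q@_m.
Proof.
rewrite mpoly2_polyE coef_sum coef_sum.
have E (m' : 'X_{1..2}) : ((Q@_m' *: 'X^(m' 1%R))%:P * 'X^(m' 0%R))`_(m 0%R)`_(m 1%R)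
   = Q@_m' *+ (m' == m) :> k.
  rewrite coefCM coefXn mulr_natr coefMn coefZ coefXn mulr_natr -mulrnA mulnb.
  have -> : (m' == m) = (m 1%R == m' 1%R) && (m 0%R == m' 0%R).
    apply/eqP/andP => [->|[/eqP h1 /eqP h0]]; first by rewrite !eqxx.
    apply/mnmP => i; case: (unliftP ord0 i) => [j ->|->]; last by [].
    by rewrite [lift _ _](_ : _ = 1%R) //; apply: val_inj; rewrite ord1.
  by [].
under eq_bigr => m' _ do rewrite E.
have [hm|hm] := boolP (m \in msupp Q).
  rewrite (bigD1_seq m) ?msupp_uniq //= eqxx big1 ?addr0 // => m' /negPf ->.
  by rewrite mulr0n.
rewrite memN_msupp_eq0 // big_seq big1 // => m' hm'; case: eqP => // e.
by rewrite -e hm' in hm.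
Qed.

Lemma horner2_mpoly2 Q b a :
  horner2 (mpoly2_poly Q) b a = mmap io (fun i : 'I_2 => if i == 0 then a else b) Q.
Proof.
rewrite /horner2 mpoly2_polyE rmorph_sum horner_sum; apply: eq_bigr => m _.
rewrite rmorphM /= map_polyC map_polyXn hornerM hornerC hornerXn /=.
rewrite /horner_eval map_polyZ map_polyXn hornerZ hornerXn /=.
rewrite -mulrA; congr (_ * _); rewrite /mmap1 big_ord_recl big_ord1 /= mulrC.
by rewrite [lift _ _](_ : _ = 1%R) //; apply: val_inj.
Qed.

Lemma horner2_phom (Phi : K -> k -> Prop) Q a b c d :
  phom io Phi -> Phi a c -> Phi b d ->
  Phi (horner2 Q b a) (map_poly (horner_eval d) Q).[c].
Proof.
move=> hPhi ac bd; apply: (phom_horner hPhi) => // i.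
by rewrite !coef_map /= /horner_eval; apply: (phom_map_poly hPhi).
Qed.

(** In a relation of least degree in [a], the coefficient [c] free of [a] is nonzero, since
    otherwise [a] could be divided out. At a point where [a] vanishes and [b] is regular, the
    relation forces the value of [b] to be a root of [c]. *)
Lemma algebraic_dependence (a b : K) (P : {mpoly k[2]}) : a != 0 -> P != 0 ->
  mmap io (fun i : 'I_2 => if i == 0 then a else b) P = 0 ->
  exists S c, c != 0 /\ horner2 S b a * a + (map_poly io c).[b] = 0.
Proof.
move=> a0 P0 hP.
have ex : exists n, `[< exists Q, [/\ Q != 0, horner2 Q b a = 0 & size Q = n] >].
  exists (size (mpoly2_poly P)); apply/asboolP; exists (mpoly2_poly P).
  split=> //; last by rewrite horner2_mpoly2.
  apply: contra_neq P0 => h; apply/mpolyP => m.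
  by rewrite -coef_mpoly2_poly h !coef0 mcoeff0.
case: (ex_minnP ex) => n /asboolP [Q [Q0 hQ <-]] nmin; move: Q0 hQ nmin.
elim/poly_ind: Q => [|S c _]; first by rewrite eqxx.
move=> Q0; rewrite /horner2 rmorphD rmorphM /= map_polyC map_polyX hornerMXaddC /=.
move=> hQ nmin; exists S, c; split=> //; apply/eqP => c0.
have S0 : S != 0 by apply: contra_neq Q0 => ->; rewrite c0 mul0r add0r.
move: hQ; rewrite c0 /horner_eval map_poly0 horner0 addr0 => /eqP.
rewrite mulf_eq0 (negPf a0) orbF => /eqP hS.
have : `[< exists Q, [/\ Q != 0, horner2 Q b a = 0 & size Q = size S] >].
  by apply/asboolP; exists S.
by move/nmin; rewrite c0 addr0 size_mulX // ltnn.
Qed.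

End AlgebraicDependence.

Lemma poly_roots (k : closedFieldType) (q : {poly k}) : q != 0 ->
  exists r : seq k, forall t, q.[t] = 0 -> t \in r.
Proof.
move=> q0; have [r hr] := closed_field_poly_normal q; exists r => t /eqP.
rewrite {1}hr hornerZ mulf_eq0 lead_coef_eq0 (negPf q0) /= => /eqP h.
by rewrite -root_prod_XsubC; apply/rootP.
Qed.

Lemma closed_field_infinite (k : closedFieldType) (s : seq k) : exists t, t \notin s.
Proof.
have : \prod_(c <- s) ('X - c%:P) != 0 :> {poly k}.
  by apply: monic_neq0; apply: monic_prod_XsubC.
by move=> /closed_nonrootP [t]; rewrite root_prod_XsubC; exists t.
Qed.

(** * Finiteness of zeros, and uniformizers, on a curve *)

Section CurveFinite.
Variables (k : closedFieldType) (C : curve k).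
Local Notation K := (ffield C).
Local Notation N1 := (amb C).+1.
Local Notation io := (femb C).
Local Notation gen := (hvec (genpt C)).
Implicit Types (x : pspace k N1) (a b : K) (F G : {mpoly k[N1]}).

Lemma curve_dependence a b : a != 0 ->
  exists S c, c != 0 /\ horner2 io S b a * a + (map_poly io c).[b] = 0.
Proof.
move=> a0; have [_ /(_ (fun i => if i == 0 then a else b))] := curve_dim C.
by move=> /existsNP [Q /not_implyP [hQ /eqP Q0]]; apply: algebraic_dependence hQ.
Qed.

Lemma curve_transcendental : exists t : K, forall c, t <> io c.
Proof.
have [[a ha] _] := curve_dim C; exists (a 0) => c hc.
have h : ('X_0 : {mpoly k[1]}) - c%:MP = 0.
  by apply: ha; rewrite mmapB mmapC mmapX mmap1U hc subrr.
have : meval (fun=> c + 1) (('X_0 : {mpoly k[1]}) - c%:MP) = 0 by rewrite h meval0.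
rewrite mevalB mevalXU mevalC addrC addKr => /eqP; by rewrite oner_eq0.
Qed.

(** Apply [curve_dependence] to F / X_i^d and X_j / X_i: at a zero of [F] with x_i nonzero, the
    ratio x_j / x_i is a root of a fixed nonzero polynomial. These ratios determine the point. *)
Lemma finite_zeros d F : F \is d.-homog -> evf io F gen != 0 ->
  exists s : seq (pspace k N1), forall x, kpts C x -> evk F (hvec x) = 0 -> x \in s.
Proof.
move=> hF F0.
have /choice [q hq] (ij : 'I_N1 * 'I_N1) : exists r : seq k, forall x, kpts C x ->
    hvec x ij.1 0 != 0 -> evk F (hvec x) = 0 ->
    hvec x ij.2 0 / hvec x ij.1 0 \in r.
  case: ij => i j /=; have [gi|gi] := eqVneq (gen i 0) 0.
    exists [::] => x hx xi0; exfalso; move: xi0.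
    by rewrite -evkX (hx _ _ (dhomogXU i)) ?eqxx // evfX.
  have hX : ('X_i ^+ d : {mpoly k[N1]}) \is d.-homog.
    by have := dhomogMn d (dhomogXU i); rewrite mul1n.
  have a0 : evf io F gen / evf io ('X_i ^+ d) gen != 0.
    by rewrite mulf_neq0 // invr_eq0 evfXn evfX expf_neq0.
  have [S [c [c0 hS]]] := curve_dependence (gen j 0 / gen i 0) a0.
  have [r hr] := poly_roots c0; exists r => x hx xi0 Fx; apply: hr.
  have P := regval_phom hx; apply: (phom0 P); rewrite -hS.
  have X0 : evk ('X_i ^+ d) (hvec x) != 0 by rewrite evkXn evkX expf_neq0.
  have ra := regval_ratio hF hX X0; rewrite Fx mul0r in ra.
  have rb : regval C x (gen j 0 / gen i 0) (hvec x j 0 / hvec x i 0).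
    rewrite -!evfX -!evkX; apply: (regval_ratio (dhomogXU j) (dhomogXU i)).
    by rewrite evkX.
  have := phomD P (phomM P (horner2_phom S P ra rb) ra) (phom_map_poly P c rb).
  by rewrite mulr0 add0r.
pose m := (\max_ij size (q ij)).
(* A candidate zero is coded by a chart [i] and, for each [j], the position of x_j / x_i in the
   finite list [q (i, j)]; [m] bounds the lengths of all these lists. *)
pose u (iphi : 'I_N1 * {ffun 'I_N1 -> 'I_m.+1}) : 'cV[k]_N1 :=
  \col_j nth 0 (q (iphi.1, j)) (iphi.2 j).
exists (pmap insub [seq <[u iphi]>%VS | iphi <- enum {: 'I_N1 * {ffun 'I_N1 -> 'I_m.+1}}]).
move=> x hx Fx; rewrite mem_pmap_sub; have [i xi0] := hvec_coord x.
pose phi := [ffun j => inord (index (hvec x j 0 / hvec x i 0) (q (i, j))) : 'I_m.+1].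
apply/mapP; exists (i, phi); first by rewrite mem_enum.
have -> : u (i, phi) = (hvec x i 0)^-1 *: hvec x.
  apply/colP => j; rewrite !mxE /= ffunE mulrC.
  have hj := hq (i, j) x hx xi0 Fx; rewrite /= mulrC in hj; rewrite inordK ?nth_index //.

  rewrite ltnS; apply: leq_trans (index_size _ _) _.
  exact: (leq_bigmax (i, j)).
have nz : (hvec x i 0)^-1 *: hvec x != 0.
  by rewrite scaler_eq0 invr_eq0 negb_or xi0 hvec_neq0.
rewrite pspace_line; apply/eqP; rewrite eqEdim !dim_vline hvec_neq0 nz andbT -memvE.
by rewrite -[X in X \in _](scalerKV xi0) memvZ // memv_line.
Qed.

Lemma almost_unit a : a != 0 -> exists s : seq (pspace k N1),
  forall x, kpts C x -> x \notin s -> exists2 c, c != 0 & regval C x a c.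
Proof.
have [d [F [G [hF hG G0 ->]]]] := ffieldE a => a0.
have F0 : evf io F gen != 0 by apply: contra_neq a0 => ->; rewrite mul0r.
have [s hs] := finite_zeros hF F0; have [s' hs'] := finite_zeros hG G0.
exists (s ++ s') => x hx; rewrite mem_cat negb_or => /andP [xs xs'].
have Fx : evk F (hvec x) != 0 by apply: contraNneq xs => /(hs _ hx).
have Gx : evk G (hvec x) != 0 by apply: contraNneq xs' => /(hs' _ hx).
by exists (evk F (hvec x) / evk G (hvec x)); [rewrite mulf_neq0 ?invr_eq0|exists d, F, G].
Qed.

(** Otherwise the maximal ideal at [x] would be zero, every function regular at [x] would be
    constant, and so would be every quotient of two such functions, that is, all of [K]. *)
Lemma unif_neq0 x pi : kpts C x -> uniformizer C x pi -> pi != 0.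
Proof.
move=> hx [hpi gpi]; apply/eqP => pi0; have P := regval_phom hx.
have triv b c : regval C x b c -> b = io c.
  move=> hb; apply/eqP; rewrite -subr_eq0; apply/eqP.
  have [|e _ ->] := gpi (b - io c); last by rewrite pi0 mul0r.
  by rewrite /maxideal /= -(subrr c); apply: (phomB P) => //; apply: phomC P _.
have [t ht] := curve_transcendental.
have [b [d [[c /triv bc] [e /triv de] _ tE]]] := frac_locring t hx.
by apply: (ht (c / e)); rewrite tE bc de fmorph_div.
Qed.

(* Instead of Krull's intersection theorem: if a is divisible by all powers of
   pi, the lowest order term of an algebraic relation between a and pi
   cannot cancel. *)
Lemma unif_separated x pi a : kpts C x -> uniformizer C x pi -> a != 0 ->
  exists n, forall b, locring C x b -> a <> pi ^+ n * b.
Proof.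
move=> hx upi a0; have P := regval_phom hx; have pi0 := unif_neq0 hx upi.
have [S [c [c0 hS]]] := curve_dependence pi a0.
(* [n] is the order of vanishing of [c] at 0. If pi^(n+1) divided [a], dividing the relation by pi^n
   and taking values at [x] would give q(0) = 0. *)
have [n [q hq qc]] := multiplicity_XsubC c 0.
rewrite c0 /= in hq; rewrite polyC0 subr0 in qc.
exists n.+1 => b [bv hb] aE; move: hq => /negP; apply; apply/rootP.
apply: (phom0 P).
have [rpi _] := upi.
have ra : regval C x a 0.
  have := phomM P (phomX P n.+1 rpi) hb; rewrite -aE expr0n /= mul0r.
  by [].
have rT := horner2_phom S P ra rpi.
suff <- : pi * b * horner2 io S pi a + (map_poly io q).[pi] = 0.
  have := phomD P (phomM P (phomM P rpi hb) rT) (phom_map_poly P q rpi).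
  by rewrite !mul0r add0r.
apply: (mulfI (expf_neq0 n pi0)); rewrite mulr0 -hS qc rmorphM /= map_polyXn hornerM hornerXn.
by rewrite aE exprSr; ring.
Qed.

End CurveFinite.

(** * Orders at a closed point of a curve *)

Section Valuations.
Variables (k : closedFieldType) (C : curve k) (x : pspace k (amb C).+1).
Local Notation K := (ffield C).
Local Notation io := (femb C).
Hypothesis hx : kpts C x.
Implicit Types (a b u pi : K).

Let P := regval_phom hx.

Definition unit_at u := exists2 c, c != 0 & regval C x u c.

Lemma unit_at_neq0 u : unit_at u -> u != 0.
Proof. by move=> [c c0 hc]; apply: contra_neq c0 => u0; apply: (phom0 P); rewrite -u0. Qed.

Lemma unit_at1 : unit_at 1.
Proof. by exists 1; [exact: oner_neq0|exact: phom_one P]. Qed.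

Lemma unit_atM u v : unit_at u -> unit_at v -> unit_at (u * v).
Proof.
move=> [c c0 hc] [d d0 hd]; exists (c * d); first exact: mulf_neq0.
exact: (phomM P).
Qed.

Lemma unit_atV u : unit_at u -> unit_at u^-1.
Proof. by move=> [c c0 hc]; exists c^-1; [rewrite invr_eq0|exact: regvalV]. Qed.

Lemma unit_atX u (m : int) : unit_at u -> unit_at (u ^ m).
Proof.
have nat_case v (n : nat) : unit_at v -> unit_at (v ^+ n).
  move=> hv; elim: n => [|n IH]; first exact: unit_at1.
  by rewrite exprS; apply: unit_atM.
move=> hu; case: m => n; first exact: nat_case.
by rewrite NegzE -exprz_inv; apply/nat_case/unit_atV.
Qed.

Lemma locring_unit u : unit_at u -> locring C x u.
Proof. by move=> [c _ hc]; exists c. Qed.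

(** The quotient of [a] by the largest power of [pi] dividing it is a unit, since a quotient
    vanishing at [x] would be divisible by [pi] once more. *)
Lemma locring_unif_unit pi a : uniformizer C x pi -> locring C x a -> a != 0 ->
  exists n u, unit_at u /\ a = pi ^+ n * u.
Proof.
move=> upi ha a0; have [N hN] := unif_separated hx upi a0.
have ex : exists n, ~~ `[< exists2 b, locring C x b & a = pi ^+ n * b >].
  by exists N; apply/asboolPn => -[b hb]; apply: hN.
case: (ex_minnP ex) => -[|n].
  by move/asboolPn => h; case: h; exists a; rewrite // mul1r.
move=> nn /(_ n) nmin.
have /asboolP [b [c hb] aE] : `[< exists2 b, locring C x b & a = pi ^+ n * b >].
  by apply: contraT => /nmin; rewrite ltnn.
exists n, b; split=> //; exists c => //.
apply: contraNneq nn => c0; apply/asboolP.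
have [|b' hb' bE] := upi.2 b; first by rewrite /maxideal /= -c0.
by exists b' => //; rewrite aE bE exprSr mulrA.
Qed.

Lemma unif_expansion pi a : uniformizer C x pi -> a != 0 ->
  exists (m : int) u, unit_at u /\ a = pi ^ m * u.
Proof.
move=> upi; have [b [d [hb hd d0 ->]]] := frac_locring a hx.
rewrite mulf_eq0 negb_or => /andP [b0 _]; have pi0 := unif_neq0 hx upi.
have [n [u [hu ->]]] := locring_unif_unit upi hb b0.
have [m [v [hv ->]]] := locring_unif_unit upi hd d0.
exists (n%:Z - m%:Z), (u / v); split; first by apply: unit_atM => //; apply: unit_atV.
rewrite expfzDr // -invr_expz -!exprnP; field.
by rewrite unit_at_neq0 // expf_neq0.
Qed.

Lemma unif_not_unit pi (n : nat) : uniformizer C x pi -> ~ unit_at (pi ^+ n.+1).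
Proof.
move=> [hpi _] [c c0 hc]; move/eqP: c0; apply.
by rewrite (phom_uniq P hc (phomX P n.+1 hpi)) expr0n.
Qed.

Lemma unif_ratio pi pi' : uniformizer C x pi -> uniformizer C x pi' ->
  unit_at (pi' / pi).
Proof.
move=> upi upi'; have pi0 := unif_neq0 hx upi.
have [b [c hb] pi'E] := upi.2 _ upi'.1; have [b' [c' hb'] piE] := upi'.2 _ upi.1.
have bb : b * b' = 1.
  by apply: (mulfI pi0); rewrite mulrA -pi'E -piE mulr1.
rewrite pi'E [pi * b]mulrC mulfK //; exists c => //.
apply/eqP => c0; have := phomM P hb hb'; rewrite c0 mul0r bb => h1.
by have := phom_uniq P (phom_one P) h1; move/eqP; rewrite oner_eq0.
Qed.

Lemma unif_exp_unit pi (m : int) : uniformizer C x pi -> unit_at (pi ^ m) -> m = 0.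
Proof.
move=> upi; case: m => [[|n]|n] //; first by move/(unif_not_unit upi).
by rewrite NegzE -exprz_inv -exprnP exprVn => /unit_atV; rewrite invrK => /(unif_not_unit upi).
Qed.

(** This makes the choice in [ord] harmless: two uniformizers differ by a unit, and a power of a
    uniformizer is a unit only for the exponent 0. *)
Lemma ord_unif pi (m : int) u : uniformizer C x pi -> unit_at u ->
  ord C x (pi ^ m * u) = m.
Proof.
move=> upi hu; rewrite /ord.
case: xgetP => [m' _ [pi' [u' [c [upi' hu' c0 e]]]]|/(_ m) []]; last first.
  by case: hu => c c0 hc; exists pi, u, c.
have {}hu' : unit_at u' by exists c.
apply/esym/eqP; rewrite -subr_eq0; apply/eqP; apply: (unif_exp_unit upi).
have pi0 := unif_neq0 hx upi; have pi'0 := unif_neq0 hx upi'.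
have -> : pi ^ (m - m') = (pi' / pi) ^ m' * u' / u.
  have u0 := unit_at_neq0 hu.
  rewrite expfzDr // (canRL (mulfK u0) e) expfzMl exprz_inv.
  by move: (pi ^ - m') (pi' ^ m') => A B; field.
by apply: unit_atM; [apply: unit_atM|exact: unit_atV] => //; apply/unit_atX/unif_ratio.
Qed.

Lemma ord_unifX pi (m : int) : uniformizer C x pi -> ord C x (pi ^ m) = m.
Proof. by move=> upi; rewrite -[pi ^ m]mulr1; apply: (ord_unif _ upi unit_at1). Qed.

Lemma ord_expansion pi a : uniformizer C x pi -> a != 0 ->
  exists u, unit_at u /\ a = pi ^ ord C x a * u.
Proof.
move=> upi /(unif_expansion upi) [m [u [hu ->]]].
by exists u; rewrite ord_unif.
Qed.

Lemma ordM a b : a != 0 -> b != 0 -> ord C x (a * b) = ord C x a + ord C x b.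
Proof.
move=> a0 b0; have [pi upi] := curve_smooth hx.
have [u [hu aE]] := ord_expansion upi a0; have [v [hv bE]] := ord_expansion upi b0.
rewrite {1}aE {1}bE mulrACA -expfzDr ?(unif_neq0 hx upi) //.
by rewrite ord_unif //; apply: unit_atM.
Qed.

Lemma ord_unit u : unit_at u -> ord C x u = 0.
Proof. by have [pi upi] := curve_smooth hx => hu; rewrite -(ord_unif 0 upi hu) mul1r. Qed.

Lemma ord_eq0 a : a != 0 -> ord C x a = 0 -> unit_at a.
Proof.
move=> a0 o; have [pi upi] := curve_smooth hx.
by have [u [hu ->]] := ord_expansion upi a0; rewrite o mul1r.
Qed.

Lemma ord_one : ord C x 1 = 0.
Proof. exact: ord_unit unit_at1. Qed.

(** Zero has no expansion, so [ord] returns its default value. With this convention [ordV] and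
    [ord_const] hold at zero as well. *)
Lemma ord_zero : ord C x 0 = 0.
Proof.
rewrite /ord; case: xgetP => // m _ [pi [u [c [upi hu c0 /esym/eqP]]]].
have hu' : unit_at u by exists c.
by rewrite mulf_eq0 (negPf (unit_at_neq0 hu')) orbF expfz_eq0 (negPf (unif_neq0 hx upi)) andbF.
Qed.

Lemma ordV a : ord C x a^-1 = - ord C x a.
Proof.
have [->|a0] := eqVneq a 0.
  by rewrite invr0 ord_zero.
have a0' : a^-1 != 0 by rewrite invr_eq0.
by have := ordM a0' a0; rewrite mulVf // ord_one; lia.
Qed.

Lemma ordX a n : a != 0 -> ord C x (a ^+ n) = ord C x a *+ n.
Proof.
move=> a0; elim: n => [|n IH]; first by rewrite expr0 ord_one.
by rewrite exprS ordM ?expf_neq0 // IH mulrS.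
Qed.

Lemma ordXz a (m : int) : a != 0 -> ord C x (a ^ m) = ord C x a * m.
Proof.
move=> a0; case: m => n; first by rewrite -exprnP ordX // -mulr_natr natz.
by rewrite NegzE -invr_expz ordV -exprnP ordX // -mulr_natr natz mulrN.
Qed.

Lemma ord_div a b : a != 0 -> b != 0 -> ord C x (a / b) = ord C x a - ord C x b.
Proof. by move=> a0 b0; rewrite ordM ?invr_eq0 // ordV. Qed.

Lemma ord_const c : ord C x (io c) = 0.
Proof.
have [->|c0] := eqVneq c 0; last by apply: ord_unit; exists c => //; apply: (phomC P).
by rewrite rmorph0 ord_zero.
Qed.

(** Zero counts as having infinite order here, whereas [ord] gives it the default order 0. *)
Definition vge (m : int) a : bool := (a == 0) || (m <= ord C x a).

Lemma vge_ord m a : a != 0 -> vge m a = (m <= ord C x a).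
Proof. by rewrite /vge => /negPf ->. Qed.

(** Turning a bound on the order into regularity yields the ultrametric inequality [vgeD], because
    the local ring is closed under sums. *)
Lemma vgeP m pi a : uniformizer C x pi ->
  vge m a <-> locring C x (pi ^ (- m) * a).
Proof.
move=> upi; have pi0 := unif_neq0 hx upi.
have [->|a0] := eqVneq a 0.
  rewrite mulr0 /vge eqxx; split=> // _; exists 0; exact: phom_zero P.
have [u [hu aE]] := ord_expansion upi a0.
rewrite vge_ord // {2}aE mulrA -expfzDr // addrC.
split=> [|[c hc]].
  rewrite -subr_ge0; case: (ord C x a - m) => // n _; have [c c0 hc] := hu.
  by exists (0 ^+ n * c); apply: (phomM P) => //; apply: (phomX P); have [] := upi.
rewrite leNgt; apply/negP; rewrite -subr_lt0 => lt0.
have : regval C x (pi ^ (m - ord C x a) * (pi ^ (ord C x a - m) * u)) (0 * c).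
  apply: (phomM P) => //; move: lt0; rewrite -oppr_gt0 opprB.
  case: (m - _) => [[|n]|n] // _; rewrite -(expr0n k n.+1 : 0 ^+ n.+1 = 0).
  by apply: (phomX P); have [] := upi.
rewrite mulrA -expfzDr // addrA subrK subrr expr0z mul1r mul0r => h0.
case: hu => d d0 hd; move/eqP: d0; apply; exact: (phom_uniq P hd h0).
Qed.

Lemma vge0P a : vge 0 a <-> locring C x a.
Proof.
have [pi upi] := curve_smooth hx; have := vgeP 0 a upi.
by rewrite oppr0 expr0z mul1r.
Qed.

Lemma vge1P a : vge 1 a <-> regval C x a 0.
Proof.
have [pi upi] := curve_smooth hx; have pi0 := unif_neq0 hx upi.
rewrite (vgeP 1 a upi); split=> [[c hc]|ha].
  have -> : a = pi * (pi ^ (-1) * a) by rewrite mulrA mulfV // mul1r.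
  by rewrite -(mul0r c); apply: (phomM P) => //; have [] := upi.
by have [b hb ->] := upi.2 a ha; rewrite mulrA mulVf // mul1r.
Qed.

Lemma vge_zero m : vge m 0.
Proof. by rewrite /vge eqxx. Qed.

Lemma vgeM m n a b : vge m a -> vge n b -> vge (m + n) (a * b).
Proof.
have [->|a0] := eqVneq a 0; first by move=> _ _; rewrite mul0r vge_zero.
have [->|b0] := eqVneq b 0; first by move=> _ _; rewrite mulr0 vge_zero.
by rewrite !vge_ord ?mulf_neq0 // ordM // => h h'; apply: lerD.
Qed.

Lemma vgeD m a b : vge m a -> vge m b -> vge m (a + b).
Proof.
have [pi upi] := curve_smooth hx.
move=> /(vgeP _ _ upi) [c hc] /(vgeP _ _ upi) [d hd]; apply/(vgeP _ _ upi).
by rewrite mulrDr; exists (c + d); apply: (phomD P).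
Qed.

Lemma vgeC m c a : vge m a -> vge m (io c * a).
Proof.
move=> ha; rewrite -[m]add0r; apply: vgeM => //.
by rewrite /vge ord_const lexx orbT.
Qed.

Lemma vge_sum m I (r : seq I) (Q : pred I) (f : I -> K) :
  (forall i, Q i -> vge m (f i)) -> vge m (\sum_(i <- r | Q i) f i).
Proof. by move=> h; apply: (big_ind (vge m)) => //; [exact: vge_zero|exact: vgeD]. Qed.

End Valuations.

(** * The product formula *)

Section SeqMultiplicities.
Variable T : eqType.
Implicit Types (s : seq T) (x : T).

Lemma count_take_mono s x m n : (m <= n)%N ->
  (count_mem x (take m s) <= count_mem x (take n s))%N.
Proof.
by move=> mn; rewrite -(cat_take_drop m (take n s)) count_cat take_takel // leq_addr.
Qed.

Lemma count_take_lt s x0 m n : (m < size s)%N -> (m < n)%N ->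
  (count_mem (nth x0 s m) (take m s) < count_mem (nth x0 s m) (take n s))%N.
Proof.
move=> ms mn; apply: leq_trans (count_take_mono _ _ mn).
by rewrite (take_nth x0) // -cats1 count_cat /= eqxx addn1.
Qed.

Lemma count_flatten_nseq s (f : T -> nat) x : uniq s ->
  count_mem x (flatten [seq nseq (f y) y | y <- s]) = (if x \in s then f x else 0)%N.
Proof.
elim: s => //= y s IH /andP [ys us]; rewrite count_cat IH // count_nseq inE /= eq_sym.
have [->|] := eqVneq x y; last by rewrite mul0n.
by rewrite (negPf ys) addn0 mul1n.
Qed.

Lemma size_flatten_nseq s (f : T -> nat) :
  size (flatten [seq nseq (f y) y | y <- s]) = (\sum_(y <- s) f y)%N.
Proof.
by elim: s => [|y s IH]; rewrite ?big_nil //= size_cat size_nseq IH big_cons.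
Qed.

End SeqMultiplicities.

Section ProductFormula.
Variables (k : closedFieldType) (C : curve k).
Local Notation K := (ffield C).
Local Notation N1 := (amb C).+1.
Local Notation io := (femb C).
Local Notation gen := (hvec (genpt C)).
Implicit Types (x y : pspace k N1) (a b : K) (F G : {mpoly k[N1]}) (D : seq (pspace k N1)).

(* The Riemann-Roch space of the effective divisor D, given as a multiset. *)
Definition rrspace D a := forall x, kpts C x -> vge x (- (count_mem x D)%:Z) a.

(** The dimension is at most deg D + 1. For empty [D] the functions are constants; a further point
    [y] adds at most one dimension, because taking the coefficient of the highest allowed pole at
    [y] is a linear form whose kernel is the smaller space. *)
Lemma rrspace_dim D N (u : 'I_N -> K) : (size D + 1 < N)%N ->
  (forall i, rrspace D (u i)) ->
  exists2 c : 'I_N -> k, exists i, c i != 0 & \sum_i io (c i) * u i = 0.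
Proof.
elim: D N u => [|y D IH] N u szD hu.
  have const i : exists c, u i = io c.
    by apply: regular_everywhere_const => x hx; apply/(vge0P hx); have := hu i x hx.
  case: N u szD hu const => [|[|N]] // u _ _ const.
  have [a ha] := const ord0; have [b hb] := const (lift ord0 ord0).
  have [a0|a0] := eqVneq a 0.
    exists (fun i => (i == ord0)%:R); first by exists ord0; rewrite eqxx oner_eq0.
    rewrite big_ord_recl ha a0 rmorph0 mulr0 add0r big1 // => i _.
    by rewrite mul0r.
  exists (fun i => if i == ord0 then b else if i == lift ord0 ord0 then - a else 0).
    by exists (lift ord0 ord0); rewrite /= oppr_eq0.
  rewrite !big_ord_recl /= ha hb big1 ?addr0; last by move=> i _; rewrite rmorph0 mul0r.
  by rewrite rmorphN mulNr mulrC subrr.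
have other x : x <> y -> count_mem x (y :: D) = count_mem x D.
  by move=> /eqP; rewrite eq_sym /= => /negPf ->.
(* The multiset may list points off the curve; they leave the space unchanged. *)
have [hy|hy] := pselect (kpts C y); last first.
  apply: (IH N u); first by apply: leq_ltn_trans szD; rewrite /= leq_add2r.
  move=> i x hx; have := hu i x hx; rewrite other //.
  by move=> e; apply: hy; rewrite -e.
case: N u szD hu => // n u szD hu.
have [pi upi] := curve_smooth hy; have pi0 := unif_neq0 hy upi.
set d := (count_mem y D).+1.
(* [d] is the largest pole order allowed at [y], and [v i] is the coefficient of that pole in
   [u i]. *)
have /choice [v hv] i : exists c, regval C y (pi ^+ d * u i) c.
  have := hu i y hy; rewrite /= eqxx add1n => /(vgeP hy _ _ upi) /=.
  by rewrite opprK => -[c hc]; exists c.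
have P := regval_phom hy.
have vge_val b : regval C y (pi ^+ d * b) 0 -> vge y (- (count_mem y D)%:Z) b.
  move=> /(vge1P hy); have [->|b0] := eqVneq b 0; first by move=> _; apply: vge_zero.
  rewrite !vge_ord ?mulf_neq0 ?expf_neq0 // ordM ?expf_neq0 //.
  by rewrite [ord C y (pi ^+ d)](ord_unifX hy d upi) /d; lia.
have [v0|/existsNP [i0 /eqP vi0]] := pselect (forall i, v i = 0).
  apply: IH; first by apply: leq_ltn_trans szD; rewrite /= leq_add2r.
  move=> i x hx; have [->|/other e] := pselect (x = y).
    by apply: vge_val; rewrite -(v0 i).
  by have := hu i x hx; rewrite e.
(* Gaussian elimination: subtracting multiples of [u i0] kills the coefficients of the pole of order
   [d] in the other functions, at the cost of one function. *)
have [|j x hx|c [j cj] hc] := IH n (fun j => u (lift i0 j) - io (v (lift i0 j) / v i0) * u i0).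
- by move: szD; rewrite /=; lia.
- have [->|/other e] := pselect (x = y).
    apply: vge_val; rewrite mulrBr mulrCA.
    have h0 := phomB P (hv (lift i0 j)) (phomM P (phomC P (v (lift i0 j) / v i0)) (hv i0)).
    by move: h0; rewrite divfK // subrr.
  rewrite -e -[- (io _ * _)]mulN1r -(rmorphN1 io) mulrA -rmorphM.
  by apply: (vgeD hx); [|apply: (vgeC hx)]; apply: hu.
exists (fun i => if unlift i0 i is Some j then c j
                 else - \sum_j c j * (v (lift i0 j) / v i0)).
  by exists (lift i0 j); rewrite liftK.
rewrite (bigD1_ord i0) //= unlift_none.
rewrite -[RHS]hc rmorphN rmorph_sum mulNr mulr_suml /= [LHS]addrC -sumrB; apply: eq_bigr => l _.
by rewrite liftK mulrBr [X in _ = _ - X]mulrA -rmorphM.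
Qed.

(** If [c i] were the first nonzero coefficient, its term would have order exactly [m] at [x] while
    all later terms have larger order, so the sum could not vanish. *)
Lemma triangular_free N (u : 'I_N -> K) :
  (forall i, exists x m, [/\ kpts C x, u i != 0, ord C x (u i) = m &
     forall j : 'I_N, (i < j)%N -> vge x (m + 1) (u j)]) ->
  forall c : 'I_N -> k, \sum_i io (c i) * u i = 0 -> forall i, c i = 0.
Proof.
move=> h c hc; suff H n : forall i : 'I_N, (i < n)%N -> c i = 0.
  by move=> i; apply: (H i.+1).
elim: n => // n IH i; rewrite ltnS => lin.
have [x [m [hx ui0 om hj]]] := h i; apply: contra_eq (om) => ci0.
have : vge x (m + 1) (io (c i) * u i).
  move: hc; rewrite (bigD1 i) //= => /eqP; rewrite addr_eq0 => /eqP ->.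
  rewrite -mulN1r -(rmorphN1 io); apply: (vgeC hx).
  apply: (vge_sum hx) => j ji; have [lt|le] := ltnP j i.
    by rewrite IH ?rmorph0 ?mul0r ?vge_zero // (leq_trans lt).
  by apply: (vgeC hx); apply: hj; rewrite ltn_neqAle le andbT eq_sym.
rewrite vge_ord ?mulf_neq0 ?fmorph_eq0 // ordM ?fmorph_eq0 // (ord_const hx).
lia.
Qed.

(** The form with coefficients 1, t, t^2, ... takes at a point [x] the value of a nonzero polynomial
    in [t]; choose [t] outside the roots of finitely many such polynomials. *)
Lemma linear_form_avoiding (s : seq (pspace k N1)) :
  exists2 H : {mpoly k[N1]}, H \is 1.-homog & forall x, x \in s -> evk H (hvec x) != 0.
Proof.
pose p x : {poly k} := \poly_(j < N1) hvec x (inord j) 0.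
have p0 : \prod_(x <- s) p x != 0.
  rewrite prodf_seq_neq0; apply/allP => x _ /=; have [i xi0] := hvec_coord x.
  by apply: contra_neq xi0 => h; have := coef0 k i; rewrite -h coef_poly ltn_ord inord_val.
have /closed_nonrootP [t] := p0; rewrite /root horner_prod prodf_seq_neq0 => /allP ht.
exists (\sum_(j < N1) t ^+ j *: 'X_j).
  by apply: rpred_sum => j _; apply/dhomogZ/dhomogXU.
move=> x /ht /=; apply: contra_neq => <-.
rewrite horner_poly /evk rmorph_sum; apply: eq_bigr => j _ /=.
by rewrite mevalZ mevalXU inord_val mulrC.
Qed.

(** The forms y_p X_q - y_q X_p vanish at [y]; if all of them vanished at [x], the two coordinate
    vectors would be proportional. *)
Lemma linear_form_separating x y : y <> x ->
  exists l : {mpoly k[N1]}, [/\ l \is 1.-homog, evk l (hvec y) = 0 & evk l (hvec x) != 0].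
Proof.
move=> yx; have ev p q (w : 'cV[k]_N1) :
    evk (hvec y p 0 *: 'X_q - hvec y q 0 *: 'X_p) w = hvec y p 0 * w q 0 - hvec y q 0 * w p 0.
  by rewrite /evk mevalB !mevalZ !mevalXU.
have [h|/existsNP [p /existsNP [q /eqP h]]] :=
    pselect (forall p q, hvec y p 0 * hvec x q 0 = hvec y q 0 * hvec x p 0).
  have [p yp] := hvec_coord y; case: yx; apply/esym.
  apply: (@hvec_inj _ _ _ _ (hvec x p 0 / hvec y p 0)).
  by apply/colP => q; rewrite mxE; apply: (mulfI yp); rewrite h; field.
exists (hvec y p 0 *: 'X_q - hvec y q 0 *: 'X_p); split.
- by rewrite rpredB ?dhomogZ ?dhomogXU.
- by rewrite ev mulrC subrr.
- by rewrite ev subr_eq0.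
Qed.

Lemma separating_function (s : seq (pspace k N1)) x :
  (forall y, y \in s -> kpts C y) -> kpts C x ->
  exists2 a, unit_at x a & forall y, y \in s -> y != x -> regval C y a 0.
Proof.
move=> hs hx; have [H hH H0] := linear_form_avoiding (x :: s).
have /choice [l hl] y : exists l : {mpoly k[N1]}, y != x ->
    [/\ l \is 1.-homog, evk l (hvec y) = 0 & evk l (hvec x) != 0].
  have [->|/eqP yx] := eqVneq y x; first by exists 0.
  by have [l ?] := linear_form_separating yx; exists l.
pose a (r : seq (pspace k N1)) := \prod_(y <- r | y != x) (evf io (l y) gen / evf io H gen).
have reg z r : z \in x :: s -> regval C z (a r)
    (\prod_(y <- r | y != x) (evk (l y) (hvec z) / evk H (hvec z))).
  move=> zs; have hz : kpts C z by move: zs; rewrite inE => /orP [/eqP ->|/hs].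
  apply: (phom_prod (regval_phom hz)) => y /hl [hl1 _ _].
  by apply: (regval_ratio hl1 hH); apply: H0.
exists (a s).
  exists (\prod_(y <- s | y != x) (evk (l y) (hvec x) / evk H (hvec x))).
    rewrite prodf_seq_neq0; apply/allP => y _ /=; apply/implyP => /hl [_ _ lx].
    by rewrite mulf_neq0 // invr_eq0 H0 ?mem_head.
  by apply: reg; apply: mem_head.
move=> y ys yx; have := reg y s; rewrite inE ys orbT => /(_ isT).
suff -> : \prod_(y0 <- s | y0 != x) (evk (l y0) (hvec y) / evk H (hvec y)) = 0 by [].
apply/eqP; rewrite prodf_seq_eq0; apply/hasP; exists y => //.
by rewrite yx /=; have [_ -> _] := hl y yx; rewrite mul0r.
Qed.

Lemma prescribed_orders (s : seq (pspace k N1)) x (j : nat) :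
  (forall y, y \in s -> kpts C y) -> kpts C x ->
  exists u, [/\ u != 0, ord C x u = j &
    forall y, y \in s -> y != x -> (count_mem y s)%:Z <= ord C y u].
Proof.
move=> hs hx; have [a ua ha] := separating_function hs hx.
have a0 := unit_at_neq0 hx ua.
have [pi upi] := curve_smooth hx; have pi0 := unif_neq0 hx upi.
(* The power a^M is a unit at [x]. At any other [y] in [s] its order is at least [M], enough to
   absorb a pole of pi^j and still leave the multiplicity of [y] in [s]. *)
pose M := (size s + \sum_(y <- s) `|ord C y (pi ^+ j)|)%N.
exists (pi ^+ j * a ^+ M); split.
- by rewrite mulf_neq0 ?expf_neq0.
- rewrite ordM ?expf_neq0 // (ordX hx M a0) (ord_unit hx ua) mul0rn addr0.
  exact: (ord_unifX hx j upi).
move=> y ys yx; have hy := hs y ys; rewrite ordM ?expf_neq0 // (ordX hy M a0).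
have : 1 <= ord C y a by rewrite -vge_ord //; apply/(vge1P hy)/ha.
have : (`|ord C y (pi ^+ j)| <= \sum_(y <- s) `|ord C y (pi ^+ j)|)%N.
  by rewrite (big_rem y) //= leq_addr.
have := count_size (pred1 y) s; rewrite /M; move: (\sum_(_ <- _) _)%N => S.
move: (ord C y (pi ^+ j)) (ord C y a) (count_mem y s) (size s) => z w c n h1 h2 h3.
have : (n + S)%N%:Z <= w * (n + S)%N by rewrite ler_peMl.
rewrite -mulr_natr natz; move: (w * _) => W.
lia.
Qed.

Lemma pole_bound a : a != 0 ->
  exists D, forall x, kpts C x -> - (count_mem x D)%:Z <= ord C x a.
Proof.
move=> a0; have [s hs] := almost_unit a0.
exists (flatten [seq nseq `|ord C y a| y | y <- undup s]) => x hx.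
rewrite count_flatten_nseq ?undup_uniq // mem_undup.
have [_|/(hs x hx) ux] := boolP (x \in s); first by lia.
by rewrite (ord_unit hx ux).
Qed.

(* The points of zs are repeated according to multiplicity.  The function
   attached to the l-th of them has there the order given by the number of
   earlier occurrences of the same point, and large order at the other points
   of zs; this makes the products of these functions with powers of a
   triangular with respect to the orders at the points of zs. *)
Lemma zeros_le_poles a (zs ps : seq (pspace k N1)) : a != 0 ->
  (forall x, x \in zs -> kpts C x) ->
  (forall x, x \in zs -> (count_mem x zs)%:Z <= ord C x a) ->
  (forall x, kpts C x -> - (count_mem x ps)%:Z <= ord C x a) ->
  (size zs <= size ps)%N.
Proof.
move=> a0 kz hz hp; rewrite leqNgt; apply/negP => lt.
have [x0 _] : exists x0 : pspace k N1, True by case: zs lt {kz hz} => // x0; exists x0.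
have kn l : (l < size zs)%N -> kpts C (nth x0 zs l) by move=> hl; apply/kz/mem_nth.
set n := size zs in lt kn *.
have /choice [u hu] l : exists u, (l < n)%N -> [/\ u != 0,
    ord C (nth x0 zs l) u = count_mem (nth x0 zs l) (take l zs) &
    forall y, y \in zs -> y != nth x0 zs l -> (count_mem y zs)%:Z <= ord C y u].
  have [hl|_] := ltnP l n; last by exists 1.
  by have [u ?] := prescribed_orders (count_mem (nth x0 zs l) (take l zs)) kz (kn l hl); exists u.
have {}hu l (hl : (l < n)%N) := hu l hl.
have uge0 l x : (l < n)%N -> x \in zs -> 0 <= ord C x (u l).
  move=> hl xz; have [_ h1 h2] := hu l hl; have [->|xl] := eqVneq x (nth x0 zs l).
    by rewrite h1.
  by apply: le_trans (h2 x xz xl).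
have ugt l l' : (l < l')%N -> (l' < n)%N ->
    (count_mem (nth x0 zs l) (take l zs))%:Z + 1 <= ord C (nth x0 zs l) (u l').
  move=> ll' hl'; have hl := ltn_trans ll' hl'; have [_ h1 h2] := hu l' hl'.
  have [e|ne] := eqVneq (nth x0 zs l) (nth x0 zs l').
    rewrite [X in ord C X]e h1 -e -(PoszD _ 1) lez_nat addn1.
    exact: count_take_lt.
  have := count_take_lt x0 hl hl; rewrite take_size => h3.
  by apply: le_trans (h2 _ (mem_nth x0 hl) ne); rewrite -(PoszD _ 1) lez_nat addn1.
have /choice [D hD] l : exists D, (l < n)%N ->
    forall x, kpts C x -> - (count_mem x D)%:Z <= ord C x (u l).
  have [hl|_] := ltnP l n; last by exists [::].
  by have [u0 _ _] := hu l hl; have [D hD] := pole_bound u0; exists D.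
(* [DD] bounds the poles of all the [u l] together. The value r = deg DD + 1 ensures n(r + 1) > deg
   DD + r deg ps + 1 as soon as n > deg ps. *)
pose DD := flatten [seq D l | l <- iota 0 n]; pose r := (size DD).+1.
have hDD l x : (l < n)%N -> kpts C x -> - (count_mem x DD)%:Z <= ord C x (u l).
  move=> hl hx; apply: le_trans (hD l hl x hx); rewrite lerN2 lez_nat.
  rewrite /DD count_flatten -map_comp sumnE big_map (big_rem l) ?mem_iota //=.
  exact: leq_addr.
(* The index [i] encodes the pair of its remainder modulo [n], which selects a function [u l], and
   its quotient by [n], which is the exponent of [a]. *)
pose U (i : 'I_(n * r.+1)) := u (i %% n)%N * a ^+ (i %/ n).
have n0 : (0 < n)%N by apply: leq_ltn_trans lt.
have modn i : (i %% n < n)%N by rewrite ltn_mod.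
have U0 i : U i != 0.
  by have [u0 _ _] := hu _ (modn i); rewrite mulf_neq0 ?expf_neq0.
have ordU x i : kpts C x -> ord C x (U i) = ord C x (u (i %% n)%N) + ord C x a *+ (i %/ n).
  move=> hx; have [u0 _ _] := hu _ (modn i).
  by rewrite ordM ?expf_neq0 // (ordX hx _ a0).
have [||c [i ci] hc] := @rrspace_dim (DD ++ flatten (nseq r ps)) _ U.
- have -> : size (DD ++ flatten (nseq r ps)) = (size DD + r * size ps)%N.
    by rewrite size_cat size_flatten /shape map_nseq sumn_nseq mulnC.
  rewrite /r; move: (size DD) (size ps) lt => d p lt.
  suff h : (d + d.+1 * p + 1 < p.+1 * d.+2)%N.
    by apply: leq_trans h _; rewrite leq_mul2r lt orbT.
  by rewrite !mulSn !mulnS; lia.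
- move=> i x hx; rewrite vge_ord // ordU // count_cat.
  have := hDD _ x (modn i) hx.
  have -> : count_mem x (flatten (nseq r ps)) = (r * count_mem x ps)%N.
    by rewrite count_flatten map_nseq sumn_nseq mulnC.
  have ir : (i %/ n <= r)%N by rewrite -ltnS ltn_divLR // [(r.+1 * _)%N]mulnC.
  have arith (q R c d : nat) (z w : int) : (q <= R)%N -> - c%:Z <= z ->
      - d%:Z <= w -> - (d + R * c)%N%:Z <= w + z * q%:Z by nia.
  by move=> h; rewrite -mulr_natr natz; apply: arith => //; apply: hp.
apply/negP: ci; rewrite negbK; apply/eqP; apply: triangular_free hc i => i.
have hl := modn i; have hx := kn _ hl; set x := nth x0 zs _ in hx.
exists x, (ord C x (U i)); split=> // j ij; rewrite vge_ord // !ordU //.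
have [_ -> _] := hu _ hl; rewrite -/x.
(* For i < j, either both exponents of [a] agree and [ugt] compares the functions [u], or [j] has a
   larger exponent. In that case the extra factor [a] contributes at least the full multiplicity of
   [x] in [zs], which exceeds the number of earlier occurrences. *)
have := leq_div2r n (ltnW ij); rewrite leq_eqVlt => /orP [/eqP e|lt'].
  have ll' : (i %% n < j %% n)%N.
    by move: ij; rewrite {1}(divn_eq i n) {1}(divn_eq j n) e ltn_add2l.
  by rewrite -e addrAC lerD2r; apply: (ugt _ _ ll' (modn j)).
have xz : x \in zs by apply: mem_nth.
have arith (q q' m d : nat) (z w : int) : (q < q')%N -> (m < d)%N -> d%:Z <= z ->
    0 <= w -> m%:Z + z *+ q + 1 <= w + z *+ q'.
  by move=> *; rewrite -(mulr_natr z q) -(mulr_natr z q') (natz q) (natz q'); nia.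
have h1 := count_take_lt x0 hl hl; rewrite take_size -/x in h1.
exact: (arith _ _ _ _ _ _ lt' h1 (hz x xz) (uge0 _ x (modn j) xz)).
Qed.

(** [zeros_le_poles] is applied to [a] and to its inverse, which exchanges zeros and poles. *)
Lemma principal_degree a (s : seq (pspace k N1)) : a != 0 -> uniq s ->
  (forall x, x \in s -> kpts C x) ->
  (forall x, kpts C x -> x \notin s -> ord C x a = 0) ->
  \sum_(x <- s) ord C x a = 0.
Proof.
move=> a0 us ks hs.
pose pp (z : int) := absz (Num.max 0 z).
pose pos b := flatten [seq nseq (pp (ord C y b)) y | y <- s].
have cpos b x : count_mem x (pos b) = (if x \in s then pp (ord C x b) else 0)%N.
  by rewrite count_flatten_nseq.
have mpos b x : x \in pos b -> x \in s.
  by rewrite -has_pred1 has_count cpos; case: ifP.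
have key b : b != 0 -> (forall x, kpts C x -> x \notin s -> ord C x b = 0) ->
    (size (pos b) <= size (pos b^-1))%N.
  move=> b0 hb; apply: (zeros_le_poles b0) => [x /mpos/ks //|x xp|x hx].
    rewrite cpos (mpos _ _ xp); have : x \in pos b by [].
    by rewrite -has_pred1 has_count cpos (mpos _ _ xp) /pp; lia.
  rewrite cpos (ordV hx); have [_|/(hb x hx) ->] := boolP (x \in s); first by rewrite /pp; lia.
  by [].
have : size (pos a) = size (pos a^-1).
  apply/eqP; rewrite eqn_leq key //= -{2}[a]invrK key ?invr_eq0 // => x hx xs.
  by rewrite (ordV hx) hs // oppr0.
rewrite !size_flatten_nseq => /(congr1 Posz); rewrite !(big_morph Posz PoszD (erefl _)).
move=> /eqP; rewrite -subr_eq0 -sumrB => /eqP e; rewrite -[RHS]e.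
by apply: eq_big_seq => x /ks hx; rewrite (ordV hx) /pp; lia.
Qed.

End ProductFormula.

(** * Transfer of identities from k to the function field *)

Section GenericPoints.
Variables (k : closedFieldType) (C : curve k).
Local Notation K := (ffield C).
Local Notation N1 := (amb C).+1.
Local Notation io := (femb C).
Implicit Types (x y : pspace k N1) (a b : K) (s : seq (pspace k N1)).

(** The point is the center of the place of k[b] sending [b] to [t]; if [b] had a pole there, 1
    would have the value 0 * t. *)
Lemma regval_surj b t : (forall c, b <> io c) -> exists2 x, kpts C x & regval C x b t.
Proof.
move=> hb; have hPhi := phom_transcendental t hb.
have [x hx hc] := phom_center hPhi; exists x => //.
have Phib : exists p, b = (map_poly io p).[b] /\ t = p.[t].
  by exists 'X; rewrite map_polyX !hornerX.
have Phi1 : exists p, 1 = (map_poly io p).[b] /\ 1 = p.[t].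
  by exists 1; rewrite rmorph1 !hornerC.
have b0 : b != 0 by apply/eqP => b0; apply: (hb 0); rewrite rmorph0.
have [ge0|lt0] := leP 0 (ord C x b).
  have /(vge0P hx) [c bc] : vge x 0 b by rewrite vge_ord.
  suff -> : t = c by [].
  by rewrite -[c]mulr1; apply: (hc _ 1 _ _ _ bc Phi1); rewrite mulr1.
have /(vge1P hx) bV : vge x 1 b^-1 by rewrite vge_ord ?invr_eq0 // ordV //; lia.
have /eqP : 1 = 0 * t by apply: (hc _ b _ _ _ bV Phib); rewrite mulVf.
by rewrite mul0r oner_eq0.
Qed.

Lemma kpts_infinite s : exists2 x, kpts C x & x \notin s.
Proof.
have [t ht] := curve_transcendental C.
have [vs hvs] : exists vs : seq k, forall x c, x \in s -> kpts C x -> regval C x t c -> c \in vs.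
  elim: s => [|y s [vs IH]]; first by exists [::].
  have [[hy [d yd]]|ny] := pselect (kpts C y /\ exists d, regval C y t d).
    exists (d :: vs) => x c; rewrite !inE => /orP [/eqP -> _ yc|xs hx xc].
      by rewrite (phom_uniq (regval_phom hy) yc yd) eqxx.
    by rewrite (IH x) ?orbT.
  exists vs => x c; rewrite inE => /orP [/eqP -> hy yc|]; last exact: IH.
  by case: ny; split=> //; exists c.
have [c hc] := closed_field_infinite vs; have [x hx xc] := regval_surj c ht.
by exists x => //; apply: contra hc => xs; apply: (hvs x).
Qed.

(** A nonzero function is a unit outside finitely many points, and the curve has infinitely many.
    Identities over [K] can thus be checked on values at almost all points. *)
Lemma generic_vanish s a : (forall x, kpts C x -> x \notin s -> regval C x a 0) -> a = 0.
Proof.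
move=> h; apply/eqP/negPn/negP => /almost_unit [s' hs'].
have [x hx] := kpts_infinite (s ++ s'); rewrite mem_cat negb_or => /andP [xs xs'].
have [c c0 xc] := hs' x hx xs'; move/eqP: c0; apply.
exact: (phom_uniq (regval_phom hx) xc (h x hx xs)).
Qed.

Lemma almost_regular (I : finType) (a : I -> K) : exists s : seq (pspace k N1), forall x,
  kpts C x -> x \notin s -> exists c : I -> k, forall i, regval C x (a i) (c i).
Proof.
have /choice [s hs] i : exists s, forall x, kpts C x -> x \notin s -> locring C x (a i).
  have [->|a0] := eqVneq (a i) 0.
    by exists [::] => x hx _; exists 0; apply: phom_zero (regval_phom hx).
  by have [s hs] := almost_unit a0; exists s => x hx /(hs x hx) /locring_unit.
exists (flatten [seq s i | i <- enum I]) => x hx xs.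
have h i : exists c, regval C x (a i) c.
  apply: hs => //; apply: contra xs => xi.
  by apply/flattenP; exists (s i) => //; apply: map_f; rewrite mem_enum.
by have [c hc] := choice h; exists c.
Qed.

End GenericPoints.

Section Representation.
Variables (k : closedFieldType) (e v : nat) (rho : glmorph k e v).

Lemma rapp1 : rapp rho idfun 1%:M = 1%:M.
Proof.
have u1 : (1%:M : 'M[k]_e) \in unitmx by apply: unitmx1.
have := rappM rho u1 u1; rewrite mulmx1 => h.
by have := mulKmx (rapp_unit rho u1) (rapp rho idfun 1%:M); rewrite -h mulVmx // rapp_unit.
Qed.

Lemma evk_act g (f : {mpoly k[v]}) w :
  evk (act rho g f) w = evk f (rapp rho idfun g *m w).
Proof.
rewrite /evk /act comp_mpoly_meval; apply: meval_eq => i.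
rewrite tnth_mktuple mxE rmorph_sum; apply: eq_bigr => j _ /=.
by rewrite mevalZ mevalXU.
Qed.

(** Choose t with t^e = det g and write [g] as t times a matrix of determinant 1. The latter fixes
    [f] and the scalar contributes t^(gamma d). The power [e] removes the root t, which may not
    exist over [K]. *)
Lemma evk_ginv_pow gamma d f (g : 'M[k]_e) w : (0 < e)%N ->
  homog_weight rho gamma -> ginv rho d f -> g \in unitmx ->
  evk f (rapp rho idfun g *m w) ^+ e = \det g ^ (gamma * d%:Z) * evk f w ^+ e.
Proof.
move=> e0 hw [hf finv] ug.
have [t te] : exists t, t ^+ e = \det g.
  have /closed_rootP [t /rootP] : size ('X^e - (\det g)%:P) != 1%N.
    by rewrite size_XnsubC // eqSS -lt0n.
  by rewrite !hornerE /= => /eqP; rewrite subr_eq0 => /eqP; exists t.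
have det0 : \det g != 0 by rewrite -unitfE -unitmxE.
have t0 : t != 0 by apply: contra_neq det0 => t0; rewrite -te t0 expr0n; case: (e) e0.
have ut : (t%:M : 'M[k]_e) \in unitmx by rewrite unitmxE det_scalar unitfE expf_neq0.
have gE : g = t%:M *m (t^-1 *: g) by rewrite mul_scalar_mx scalerA mulfV // scale1r.
have ug' : t^-1 *: g \in unitmx.
  by move: ug; rewrite {1}gE unitmx_mul => /andP [].
have det1 : \det (t^-1 *: g) = 1 by rewrite detZ exprVn te mulVf.
rewrite {1}gE rappM // hw // mul_scalar_mx -scalemxAl (evk_homogZ _ _ hf) -evk_act finv //.
rewrite exprMn; congr (_ * _); rewrite -te.
by rewrite !exprnP !exprz_exp; congr (t ^ _); rewrite mulrA mulrC.
Qed.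

End Representation.

(** * The representation on matrices over the function field *)

Section Transfer.
Variables (k : closedFieldType) (C : curve k) (e v : nat) (rho : glmorph k e v).
Local Notation K := (ffield C).
Local Notation N1 := (amb C).+1.
Local Notation io := (femb C).
Implicit Types (x : pspace k N1) (g h : 'M[K]_e).

Definition regmx x m n (A : 'M[K]_(m, n)) (A0 : 'M[k]_(m, n)) :=
  forall i j, regval C x (A i j) (A0 i j).

Lemma almost_regmx m n (A : 'M[K]_(m, n)) : exists s : seq (pspace k N1), forall x,
  kpts C x -> x \notin s -> exists A0, regmx x A A0.
Proof.
have [s hs] := almost_regular (fun ij : 'I_m * 'I_n => A ij.1 ij.2).
exists s => x hx /(hs x hx) [c hc]; exists (\matrix_(i, j) c (i, j)) => i j.
by rewrite mxE; apply: (hc (i, j)).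
Qed.

Lemma regmxM x m n p (A : 'M[K]_(m, n)) A0 (B : 'M[K]_(n, p)) B0 : kpts C x ->
  regmx x A A0 -> regmx x B B0 -> regmx x (A *m B) (A0 *m B0).
Proof.
move=> hx hA hB i j; rewrite !mxE; apply: (phom_sum (regval_phom hx)) => l _.
exact: (phomM (regval_phom hx)).
Qed.

Lemma regmx_rapp x g (g0 : 'M[k]_e) : kpts C x -> regmx x g g0 -> \det g0 != 0 ->
  regmx x (rapp rho io g) (rapp rho idfun g0).
Proof.
move=> hx hg d0 a b; have P := regval_phom hx.
rewrite !mxE; apply: (phomM P).
  apply: (phom_mmap P) => l; case/mxvec_indexP: l => i j.
  by rewrite !mxvecE.
apply: regvalV; last by rewrite expf_neq0.
exact/(phomX P)/(phom_det P).
Qed.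

Lemma almost_unitmx g : g \in unitmx ->
  exists s : seq (pspace k N1), forall x, kpts C x -> x \notin s ->
  exists g0 : 'M[k]_e, [/\ regmx x g g0, g0 \in unitmx & \det g0 != 0].
Proof.
rewrite unitmxE unitfE => d0; have [s hs] := almost_regmx g.
have [s' hs'] := almost_unit d0; exists (s ++ s') => x hx.
rewrite mem_cat negb_or => /andP [/(hs x hx) [g0 hg] /(hs' x hx) [c c0 hc]].
exists g0; rewrite unitmxE unitfE.
have P := regval_phom hx.
have -> : \det g0 = c by apply: (phom_uniq P (phom_det P hg) hc).
by [].
Qed.

(** Multiplicativity is given for matrices over [k]; over [K] both sides are compared through their
    values at almost all points. *)
Lemma rappM_ffield g h : g \in unitmx -> h \in unitmx ->
  rapp rho io (g *m h) = rapp rho io g *m rapp rho io h.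
Proof.
move=> /almost_unitmx [s hs] /almost_unitmx [s' hs'].
apply/matrixP => a b; apply/eqP; rewrite -subr_eq0; apply/eqP.
apply: (@generic_vanish _ _ (s ++ s')) => x hx; rewrite mem_cat negb_or.
move=> /andP [/(hs x hx) [g0 [hg ug dg]] /(hs' x hx) [h0 [hh uh dh]]].
have P := regval_phom hx.
have d0 : \det (g0 *m h0) != 0 by rewrite det_mulmx mulf_neq0.
have := phomB P (regmx_rapp hx (regmxM hx hg hh) d0 a b)
  (regmxM hx (regmx_rapp hx hg dg) (regmx_rapp hx hh dh) a b).
by rewrite rappM // subrr.
Qed.

Lemma rapp1_ffield : rapp rho io 1%:M = 1%:M.
Proof.
apply/matrixP => a b; apply/eqP; rewrite -subr_eq0; apply/eqP.
apply: (@generic_vanish _ _ [::]) => x hx _; have P := regval_phom hx.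
have one n : @regmx x n n 1%:M 1%:M.
  by move=> i j; rewrite !mxE -(rmorph_nat io); apply: (phomC P).
have d1 : \det (1%:M : 'M[k]_e) != 0 by rewrite det1 oner_eq0.
have := phomB P (regmx_rapp hx (@one e) d1 a b) (@one v a b).
by rewrite rapp1 subrr.
Qed.

Lemma rapp_unit_ffield g : g \in unitmx -> rapp rho io g \in unitmx.
Proof.
move=> ug; have ug' : invmx g \in unitmx by rewrite unitmx_inv.
have := rappM_ffield ug ug'; rewrite mulmxV // rapp1_ffield => h.
by have /mulmx1_unit [] := esym h.
Qed.

Lemma regval_expz x a c (m : int) : kpts C x -> regval C x a c -> c != 0 ->
  regval C x (a ^ m) (c ^ m).
Proof.
move=> hx ac c0; case: m => n; first exact: (phomX (regval_phom hx)).
by rewrite !NegzE -!exprz_inv; apply/(phomX (regval_phom hx))/regvalV.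
Qed.

Lemma evf_ginv_pow gamma d f g (w : 'cV[K]_v) : (0 < e)%N ->
  homog_weight rho gamma -> ginv rho d f -> g \in unitmx ->
  evf io f (rapp rho io g *m w) ^+ e = \det g ^ (gamma * d%:Z) * evf io f w ^+ e.
Proof.
move=> e0 hw hf /almost_unitmx [s hs]; have [s' hs'] := almost_regmx w.
apply/eqP; rewrite -subr_eq0; apply/eqP.
apply: (@generic_vanish _ _ (s ++ s')) => x hx; rewrite mem_cat negb_or.
move=> /andP [/(hs x hx) [g0 [hg ug dg]] /(hs' x hx) [w0 hw0]].
have P := regval_phom hx.
have hy := regmxM hx (regmx_rapp hx hg dg) hw0.
have := phomB P (phomX P e (phom_evf P f (fun j => hy j 0)))
  (phomM P (regval_expz (gamma * d%:Z) hx (phom_det P hg) dg)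
           (phomX P e (phom_evf P f (fun j => hw0 j 0)))).
by rewrite (evk_ginv_pow _ e0 hw hf ug) subrr.
Qed.

End Transfer.

(** * Specialization and degrees *)

Section Specialization.
Variables (k : closedFieldType) (C : curve k) (x : pspace k (amb C).+1).
Local Notation K := (ffield C).
Local Notation io := (femb C).
Hypothesis hx : kpts C x.
Let P := regval_phom hx.

Definition minord v (y : 'cV[K]_v) (m : int) :=
  (exists2 j, y j 0 != 0 & ord C x (y j 0) = m) /\ (forall j, vge x m (y j 0)).

Lemma minord_exists v (y : 'cV[K]_v) : y != 0 -> exists m, minord y m.
Proof.
move=> /cV0Pn [j0 yj0].
have [j yj jmin] := @Order.TotalTheory.arg_minP _ int _ j0 (fun j => y j 0 != 0)
  (fun j => ord C x (y j 0)) yj0.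
exists (ord C x (y j 0)); split; first by exists j.
move=> l; have [->|yl] := eqVneq (y l 0) 0; first exact: vge_zero.
by rewrite vge_ord // jmin.
Qed.

Lemma minord_le v (y : 'cV[K]_v) m m' : minord y m -> (forall j, vge x m' (y j 0)) -> m' <= m.
Proof. by move=> [[j yj <-] _] /(_ j); rewrite vge_ord. Qed.

Lemma vge_mulmx m n (A : 'M[K]_(m, n)) (y : 'cV[K]_n) (l : int) :
  (forall i j, locring C x (A i j)) -> (forall j, vge x l (y j 0)) ->
  forall i, vge x l ((A *m y) i 0).
Proof.
move=> hA hy i; rewrite mxE; apply: (vge_sum hx) => j _.
by rewrite -[l]add0r; apply: (vgeM hx) => //; apply/(vge0P hx).
Qed.

(** Dividing by a coordinate of least order makes all coordinates regular and one of them equal to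
    1. The constant [l] adjusts to the representative [hvec q] of the resulting line. *)
Lemma minord_specializes v (y : 'cV[K]_v) m : minord y m ->
  exists2 q, specializes x y q & exists c, [/\ c != 0, ord C x c = - m &
    forall j, regval C x (c * y j 0) (hvec q j 0)].
Proof.
move=> [[j0 yj0 oj0] hy].
have /choice [u hu] j : exists c, regval C x ((y j0 0)^-1 * y j 0) c.
  apply/(vge0P hx); rewrite -(addNr m); apply: (vgeM hx) => //.
  by rewrite vge_ord ?invr_eq0 // (ordV hx) oj0.
have uj0 : u j0 = 1.
  by apply: (phom_uniq P (hu j0)); rewrite mulVf //; apply: phom_one P.
have [q [l l0 hq]] : exists q, exists2 l, l != 0 & hvec q = l *: \col_j u j.
  by apply: hvec_surj; apply/cV0Pn; exists j0; rewrite mxE uj0 oner_eq0.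
have reg j : regval C x (io l / y j0 0 * y j 0) (hvec q j 0).
  by rewrite hq !mxE -mulrA; apply: (phomM P) => //; apply: (phomC P).
have c0 : io l / y j0 0 != 0 by rewrite mulf_neq0 ?invr_eq0 ?fmorph_eq0.
exists q; exists (io l / y j0 0) => //; split=> //.
by rewrite (ordM hx) ?invr_eq0 ?fmorph_eq0 // (ord_const hx) (ordV hx) oj0 add0r.
Qed.

Lemma specializes_minord v (y : 'cV[K]_v) q j : specializes x y q -> hvec q j 0 != 0 ->
  y j 0 != 0 /\ minord y (ord C x (y j 0)).
Proof.
move=> [c c0 hc] qj; have uj : unit_at x (c * y j 0) by exists (hvec q j 0).
have yj : y j 0 != 0.
  by have := unit_at_neq0 hx uj; rewrite mulf_eq0 negb_or => /andP [].
have := ord_unit hx uj; rewrite (ordM hx) // => oc.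
split=> //; split; first by exists j.
move=> l; have : vge x 0 (c * y l 0) by apply/(vge0P hx); exists (hvec q l 0).
have [->|yl] := eqVneq (y l 0) 0; first by move=> _; apply: vge_zero.
rewrite !vge_ord ?mulf_neq0 // (ordM hx) //; lia.
Qed.

Lemma ord_homog v d (f : {mpoly k[v]}) (y : 'cV[K]_v) m q c : f \is d.-homog ->
  c != 0 -> ord C x c = - m -> (forall j, regval C x (c * y j 0) (hvec q j 0)) ->
  [/\ vge x (m *+ d) (evf io f y),
      evk f (hvec q) != 0 -> evf io f y != 0 /\ ord C x (evf io f y) = m *+ d &
      evf io f y != 0 -> ord C x (evf io f y) = m *+ d -> evk f (hvec q) != 0].
Proof.
move=> hf c0 oc hc.
have hfc : regval C x (c ^+ d * evf io f y) (evk f (hvec q)).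
  by rewrite -(evf_homogZ _ _ _ hf); apply: (phom_evf P) => j; rewrite mxE.
have ocd : ord C x (c ^+ d) = - (m *+ d) by rewrite (ordX hx) // oc mulNrn.
have cd0 : c ^+ d != 0 by rewrite expf_neq0.
split.
- have [->|f0] := eqVneq (evf io f y) 0; first exact: vge_zero.
  have : vge x 0 (c ^+ d * evf io f y) by apply/(vge0P hx); exists (evk f (hvec q)).
  by rewrite !vge_ord ?mulf_neq0 // (ordM hx) // ocd addrC subr_ge0.
- move=> q0; have uf : unit_at x (c ^+ d * evf io f y) by exists (evk f (hvec q)).
  have f0 : evf io f y != 0.
    by have := unit_at_neq0 hx uf; rewrite mulf_eq0 negb_or => /andP [].
  have := ord_unit hx uf; rewrite (ordM hx) // ocd addrC => /eqP.
  by rewrite subr_eq0 => /eqP.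
- move=> f0 of0; have [||d0 d00 hd] := @ord_eq0 _ _ _ hx (c ^+ d * evf io f y).
  + by rewrite mulf_neq0.
  + by rewrite (ordM hx) // ocd of0 addNr.
  + by rewrite (phom_uniq P hfc hd).
Qed.

End Specialization.

Section Degree.
Variables (k : closedFieldType) (C : curve k) (r : nat) (E : cocycle C r).
Local Notation K := (ffield C).
Local Notation N1 := (amb C).+1.

(** This makes the order at [x] of a section of the determinant independent of the chart. *)
Definition det_unramified := forall x i j, kpts C x -> copen i x -> copen j x ->
  ord C x (\det (ctrans (c := E) i j)) = 0.

Lemma detsec_ord (s : cidx E -> K) x i j : det_unramified -> detsec E s ->
  kpts C x -> copen i x -> copen j x -> ord C x (s i) = ord C x (s j).
Proof.
move=> hE [s0 hs] hx xi xj; rewrite (hs i j) (ordM hx) ?(hE x i j) ?add0r //.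
by have := s0 i; rewrite (hs i j) mulf_eq0 negb_or => /andP [].
Qed.

Lemma secordE (s : cidx E -> K) x i : det_unramified -> detsec E s ->
  kpts C x -> copen i x -> secord E s x = ord C x (s i).
Proof.
move=> hE hs hx xi; rewrite /secord; case: xgetP => [m _ [j xj ->]|/(_ (ord C x (s i))) []].
  exact: detsec_ord hE hs hx xj xi.
by exists i.
Qed.

(** This justifies the choice in [deg]: two sections differ by one rational function [c], whose
    divisor has degree 0 by [principal_degree]. *)
Lemma deg_secord (s : cidx E -> K) (S : seq (pspace k N1)) :
  (forall x, kpts C x -> exists i : cidx E, copen i x) -> det_unramified ->
  detsec E s -> uniq S -> (forall x, x \in S -> kpts C x) ->
  (forall x (i : cidx E), kpts C x -> x \notin S -> copen i x -> ord C x (s i) = 0) ->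
  deg E = \sum_(x <- S) secord E s x.
Proof.
move=> cov hE hs uS kS h0; rewrite /deg.
case: xgetP => [m _ [t ht ->]|/(_ (\sum_(x \in kpts C) secord E s x)%R) []]; last by exists s.
have [[i0 _]|none] := pselect (exists i : cidx E, True); last first.
  have nk x : ~ kpts C x by move=> /cov [i _]; apply: none; exists i.
  rewrite fsbig1; last by move=> x /nk.
  by rewrite big_seq big1 // => x /kS /nk.
pose c := t i0 / s i0.
have c0 : c != 0 by rewrite mulf_neq0 ?invr_eq0 //; [apply: ht.1|apply: hs.1].
have tE i : t i = c * s i.
  by rewrite /c (ht.2 i i0) (hs.2 i i0); field; apply: hs.1.
have [Z hZ] := almost_unit c0.
(* The list [S] is enlarged by the zeros and poles of [c], so that it also supports the chosen
   section [t]. *)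
pose S' := undup (S ++ [seq x <- Z | `[< kpts C x >]]).
have kS' x : x \in S' -> kpts C x.
  by rewrite mem_undup mem_cat mem_filter => /orP [/kS //|/andP [/asboolP]].
have SS' x : x \notin S' -> x \notin S by apply: contra; rewrite mem_undup mem_cat => ->.
have ordc x : kpts C x -> x \notin S' -> ord C x c = 0.
  move=> hx xS'; have [|d d0 hd] := hZ x hx; last by apply: (ord_unit hx); exists d.
  by apply: contra xS' => xZ; rewrite mem_undup mem_cat mem_filter xZ (asboolT hx) orbT.
have sect x : kpts C x -> secord E t x = ord C x c + secord E s x.
  move=> hx; have [i xi] := cov x hx.
  by rewrite !(secordE hE _ hx xi) // tE (ordM hx) //; apply: hs.1.
have -> : (\sum_(x \in kpts C) secord E t x)%R = \sum_(x <- S' | x \in kpts C) secord E t x.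
  apply: fsbigE; rewrite ?undup_uniq //.
  move=> x hx xS'; rewrite sect // ordc // add0r; have [i xi] := cov x hx.
  by rewrite (secordE hE _ hx xi) // h0 // SS'.
rewrite big_seq_cond (eq_bigl (fun x => x \in S')); last first.
  by move=> x; case xS': (x \in S') => //=; apply/mem_set/kS'.
rewrite (eq_bigr (fun x => ord C x c + secord E s x)); last by move=> x /kS' /sect.
rewrite big_split /= -!big_seq (principal_degree c0) ?undup_uniq // add0r.
rewrite (bigID (fun x => x \in S)) /= [X in _ + X]big1_seq ?addr0; last first.
  move=> x /andP [xS /kS' hx]; have [i xi] := cov x hx.
  by rewrite (secordE hE _ hx xi) // h0.
rewrite -big_filter; apply: perm_big; apply: uniq_perm; rewrite ?filter_uniq ?undup_uniq //.
move=> x; rewrite mem_filter mem_undup mem_cat; case: (x \in S) => //.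
Qed.

End Degree.

(** * The line bundles of the theorem *)

Section Invariants.
Variables (k : closedFieldType) (e v : nat) (rho : glmorph k e v) (L : gitpol rho).

Lemma ginvX d f n : ginv rho d f -> ginv rho (d * n) (f ^+ n).
Proof.
move=> [hf hinv]; split; first exact: dhomogMn.
by move=> g dg; rewrite /act rmorphXn /=; congr (_ ^+ _); apply: hinv.
Qed.

(** If [f] of degree [d] does not vanish at [Q], neither does its power of exponent [pdeg L], which
    is a sum of products of [d] invariants of degree [pdeg L]; so one of these is nonzero at [Q]. *)
Lemma semistable_pdeg (F : fieldType) (io : {rmorphism k -> F}) (Q : pspace F v) :
  semistable rho io Q -> exists2 f, ginv rho (pdeg L) f & evf io f (hvec Q) != 0.
Proof.
move=> [d [f [d0 hf fQ]]]; apply: contrapT => none.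
have zero g : ginv rho (pdeg L) g -> evf io g (hvec Q) = 0.
  by move=> hg; apply/eqP/negPn/negP => gQ; apply: none; exists g.
have [s [hs fE]] := pdeg_gen d0 (ginvX (pdeg L) hf).
have : evf io (f ^+ pdeg L) (hvec Q) != 0 by rewrite /evf rmorphXn expf_neq0.
rewrite fE /evf rmorph_sum big1_seq ?eqxx // => t /andP [_ ts].
by rewrite rmorph_prod (bigD1 (Ordinal d0)) //= [X in X * _]zero ?mul0r //; apply: hs.
Qed.

End Invariants.

Section LineBundles.
Variables (k : closedFieldType) (C : curve k) (e v : nat) (rho : glmorph k e v).
Variable L : gitpol rho.
Local Notation K := (ffield C).
Local Notation N1 := (amb C).+1.
Local Notation io := (femb C).
Implicit Types (x : pspace k N1) (P : pspace K v).

Lemma qbar_chart_le d P f g x : qbar_chart rho d P f x -> ginv rho d g ->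
  evf io f (hvec P) != 0 -> evf io g (hvec P) != 0 ->
  ord C x (evf io f (hvec P)) <= ord C x (evf io g (hvec P)).
Proof.
move=> [hx hreg] hg fP gP; rewrite -subr_ge0 -ord_div // -vge_ord ?mulf_neq0 ?invr_eq0 //.
by apply/(vge0P hx); have := hreg 1%N g; rewrite mul1n expr1; apply.
Qed.

(* A chart f is regular at x as soon as f has minimal order among the invariants
   of degree pdeg L, since these generate the Veronese subring. *)
Lemma qbar_chartE P f x : kpts C x -> ginv rho (pdeg L) f -> evf io f (hvec P) != 0 ->
  (forall g, ginv rho (pdeg L) g -> evf io g (hvec P) != 0 ->
    ord C x (evf io f (hvec P)) <= ord C x (evf io g (hvec P))) ->
  qbar_chart rho (pdeg L) P f x.
Proof.
move=> hx hf fP fmin; split=> // r a ha; apply/(vge0P hx).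
case: r ha => [|r] ha.
  rewrite expr0 divr1; have [m hm] := minord_exists x (hvec_neq0 P).
  have [q _ [c [c0 oc hc]]] := minord_specializes hx hm.
  have [ha0 _] := ha.
  by have [] := ord_homog hx ha0 c0 oc hc.
have [s [hs ->]] := pdeg_gen (ltn0Sn r) ha.
rewrite /evf rmorph_sum mulr_suml big_seq; apply: (vge_sum hx) => t ts.
rewrite rmorph_prod -[in X in _ / X](card_ord r.+1) -prodr_const -prodf_div /=.
have one : vge x 0 (1 : K) by rewrite vge_ord ?oner_eq0 // (ord_one hx).
apply: (big_ind (vge x 0)) => // [a1 a2 h1 h2|i _]; first by rewrite -[0]addr0; apply: (vgeM hx).
have hi := hs t ts i; rewrite -!/(evf io _ (hvec P)).
have [->|ti] := eqVneq (evf io (tnth t i) (hvec P)) 0; first by rewrite mul0r vge_zero.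
by rewrite vge_ord ?mulf_neq0 ?invr_eq0 // ord_div // subr_ge0; apply: fmin.
Qed.

(** The orders at [x] of the invariants of degree [pdeg L] are bounded below in terms of the
    coordinates of [P], so one of them has least order and [qbar_chartE] applies to it. *)
Lemma qbar_cover P x : semistable rho io P -> kpts C x ->
  exists f, [/\ ginv rho (pdeg L) f, evf io f (hvec P) != 0 & qbar_chart rho (pdeg L) P f x].
Proof.
move=> hP hx; have [f0 hf0 f0P] := semistable_pdeg L hP.
have [m hm] := minord_exists x (hvec_neq0 P).
have [q _ [c [c0 oc hc]]] := minord_specializes hx hm.
have low f : ginv rho (pdeg L) f -> evf io f (hvec P) != 0 ->
    m *+ pdeg L <= ord C x (evf io f (hvec P)).
  by move=> [hf _] fP; have [h _ _] := ord_homog hx hf c0 oc hc; rewrite -vge_ord.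
pose Q n := `[< exists f, [/\ ginv rho (pdeg L) f, evf io f (hvec P) != 0 &
  ord C x (evf io f (hvec P)) = m *+ pdeg L + n%:Z] >].
have ex : exists n, Q n.
  exists (absz (ord C x (evf io f0 (hvec P)) - m *+ pdeg L)); apply/asboolP; exists f0.
  by split=> //; rewrite gez0_abs ?subr_ge0 ?low // [RHS]addrC subrK.
case: (ex_minnP ex) => n /asboolP [f [hf fP fn]] nmin; exists f; split=> //.
apply: qbar_chartE => // g hg gP; rewrite fn.
have gn : ord C x (evf io g (hvec P)) =
    m *+ pdeg L + (absz (ord C x (evf io g (hvec P)) - m *+ pdeg L))%:Z.
  by rewrite gez0_abs ?subr_ge0 ?low // [RHS]addrC subrK.
rewrite gn lerD2l lez_nat; apply: nmin; apply/asboolP; by exists g.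
Qed.

(** The rational section of O(d) that takes the value 1 on the vector [hvec P]. *)
Definition qbar_sec P (f : cidx (qbar_O rho (pdeg L) P)) : K :=
  (evf io (sval f) (hvec P))^-1.

Lemma qbar_detsec P : detsec (qbar_O rho (pdeg L) P) (@qbar_sec P).
Proof.
split=> [f|f g]; first by rewrite invr_eq0; case: (svalP f).
rewrite det_scalar expr1 /qbar_sec; have [_ f0] := svalP f; have [_ g0] := svalP g.
by field; apply/andP.
Qed.

Lemma qbar_unramified P : det_unramified (qbar_O rho (pdeg L) P).
Proof.
move=> x f g hx hf hg; rewrite det_scalar expr1.
have [f1 f0] := svalP f; have [g1 g0] := svalP g.
rewrite ord_div //; apply/eqP; rewrite subr_eq0 eq_le.
by rewrite (qbar_chart_le hf) // (qbar_chart_le hg).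
Qed.

(** One finite set has to serve all charts. Outside it the coordinates of [P] are regular, so
    invariants have order at least 0, and a fixed invariant [f0] is a unit, so the least order is
    0. *)
Lemma qbar_support P : semistable rho io P -> exists S : seq (pspace k N1),
  forall x (f : cidx (qbar_O rho (pdeg L) P)), kpts C x -> x \notin S ->
    copen f x -> ord C x (qbar_sec f) = 0.
Proof.
move=> hP; have [f0 hf0 f0P] := semistable_pdeg L hP.
have [S hS] := almost_unit f0P.
have [S' hS'] := almost_regular (fun j => hvec P j 0).
exists (S ++ S') => x f hx; rewrite mem_cat negb_or => /andP [xS xS'] xf.
have [c c0 hc] := hS x hx xS; have [w hw] := hS' x hx xS'.
have [f1 fP] := svalP f; rewrite /qbar_sec (ordV hx).
suff -> : ord C x (evf io (sval f) (hvec P)) = 0 by [].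
have o0 : ord C x (evf io f0 (hvec P)) = 0 by apply: (ord_unit hx); exists c.
apply/eqP; rewrite eq_le -{1}o0 (qbar_chart_le xf) //= -vge_ord //.
apply/(vge0P hx); exists (evk (sval f) (\col_j w j)).
by apply: (phom_evf (regval_phom hx)) => j; rewrite mxE.
Qed.

End LineBundles.

(** * The section of P(E^rho) and the pull-back of O(1) *)

Section Bundle.
Variables (k : closedFieldType) (C : curve k) (e v : nat) (rho : glmorph k e v).
Local Notation K := (ffield C).
Local Notation N1 := (amb C).+1.
Local Notation io := (femb C).
Variables (E : cocycle C e) (hE : vbundle E) (tau : cidx E -> 'M[K]_e) (htau : gtriv E tau).
Implicit Types (x : pspace k N1) (P : pspace K v) (i j : cidx E).

Local Notation chart := (@chart_vec k C e v rho E tau).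
Local Notation pbar := (@Pbar k C e v rho E tau).

Lemma ctrans_regmx x i j : copen i x -> copen j x ->
  exists A0, regmx x (ctrans i j) A0.
Proof.
move=> xi xj; have [_ _ hreg _ _] := hE.
have h (ab : 'I_e * 'I_e) : exists c, regval C x (ctrans i j ab.1 ab.2) c by apply: hreg.
have [A0 hA] := choice h; exists (\matrix_(a, b) A0 (a, b)) => a b.
by rewrite mxE; apply: (hA (a, b)).
Qed.

Lemma ctrans_inv i j : ctrans i j *m ctrans j i = 1%:M.
Proof. by have [_ _ _ h1 h2] := hE; rewrite h2 h1. Qed.

Lemma ctrans_det_regmx x i j : kpts C x -> copen i x -> copen j x ->
  exists A0, regmx x (ctrans i j) A0 /\ \det A0 != 0.
Proof.
move=> hx xi xj; have [A0 hA] := ctrans_regmx xi xj; exists A0; split=> //.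
have [B0 hB] := ctrans_regmx xj xi; have P := regval_phom hx.
have := phom_det P (regmxM hx hA hB); rewrite ctrans_inv det1 => h1.
have := phom_uniq P h1 (phom_one P); rewrite det_mulmx => AB.
by apply/eqP => A00; move/eqP: AB; rewrite A00 mul0r eq_sym oner_eq0.
Qed.

Lemma bundle_unramified : det_unramified E.
Proof.
move=> x i j hx xi xj; have [A0 [hA dA]] := ctrans_det_regmx hx xi xj.
by apply: (ord_unit hx); exists (\det A0) => //; apply: (phom_det (regval_phom hx)).
Qed.

Lemma det_triv_detsec : detsec E (fun i => \det (tau i)).
Proof.
have [h1 h2] := htau; split=> [i|i j]; first by rewrite -unitfE -unitmxE.
by rewrite -det_mulmx -h2.
Qed.

Lemma copen_cofinite i : exists S : seq (pspace k N1),
  forall x, kpts C x -> x \notin S -> copen i x.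
Proof.
have [/(_ i) [[T [hT Ui]] [x0 x0i]] _ _ _ _] := hE.
move: x0i; rewrite Ui /= => -[hx0 [F TF F0]]; have [d hF] := hT F TF.
have [S hS] := finite_zeros hF (evf_neq0 hx0 hF F0).
exists S => x hx xS; rewrite /=; split=> //; exists F => //.
by apply: contraNneq xS => /(hS _ hx).
Qed.

Lemma det_triv_support : exists S : seq (pspace k N1), forall x i, kpts C x -> x \notin S ->
  copen i x -> ord C x (\det (tau i)) = 0.
Proof.
have [[i0 _]|none] := pselect (exists i : cidx E, True); last first.
  by exists [::] => x i; case: none; exists i.
have [S hS] := copen_cofinite i0.
have [S' hS'] := almost_unit (det_triv_detsec.1 i0).
exists (S ++ S') => x i hx; rewrite mem_cat negb_or => /andP [xS xS'] xi.
rewrite (detsec_ord bundle_unramified det_triv_detsec hx xi (hS x hx xS)).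
by have [c c0 hc] := hS' x hx xS'; apply: (ord_unit hx); exists c.
Qed.

Lemma chart_vec_trans P i j :
  chart P i = rapp rho io (ctrans i j) *m chart P j.
Proof.
have [h1 h2] := htau.
have uc : ctrans i j \in unitmx by have [] := mulmx1_unit (ctrans_inv i j).
by rewrite /chart_vec /assoc_triv mulmxA -rappM_ffield // -h2.
Qed.

Lemma chart_vec_neq0 P i : chart P i != 0.
Proof.
have u := rapp_unit_ffield rho (htau.1 i).
apply: contra_neq (hvec_neq0 P) => h; rewrite -[hvec P](mulKmx u).
by rewrite [X in _ *m X]h mulmx0.
Qed.

(** The matrix of [rho] at the transition between two charts is regular at [x], so it cannot lower
    the least order of the coordinates. *)
Lemma chart_minord_le P i j x m m' : kpts C x -> copen i x -> copen j x ->
  minord x (chart P i) m -> minord x (chart P j) m' -> m' <= m.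
Proof.
move=> hx xi xj hm [_ hm']; apply: (minord_le hm) => a.
have [A0 [hA dA]] := ctrans_det_regmx hx xi xj.
rewrite (chart_vec_trans P i j); apply: (vge_mulmx hx) => // b c.
by exists (rapp rho idfun A0 b c); apply: regmx_rapp.
Qed.

Lemma chart_minord_eq P i j x m m' : kpts C x -> copen i x -> copen j x ->
  minord x (chart P i) m -> minord x (chart P j) m' -> m = m'.
Proof.
move=> hx xi xj hm hm'; apply/eqP; rewrite eq_le.
by rewrite (chart_minord_le hx xj xi hm' hm) (chart_minord_le hx xi xj hm hm').
Qed.

(** The rational section of O(1) that takes the value 1 on [hvec P], matching [qbar_sec]. *)
Definition pbar_sec P (a : cidx (Pbar_O1 rho tau P)) : K :=
  (chart P (sval a).1 (sval a).2 0)^-1.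

Lemma pbar_detsec P : detsec (Pbar_O1 rho tau P) (@pbar_sec P).
Proof.
split=> [a|a b]; first by rewrite invr_eq0; apply: (svalP a).
rewrite det_scalar expr1 /pbar_sec; have a0 := svalP a; have b0 := svalP b.
by field; apply/andP.
Qed.

Lemma pbar_chart_minord P (a : cidx (Pbar_O1 rho tau P)) x : copen a x ->
  [/\ kpts C x, @copen _ _ _ E (sval a).1 x &
      minord x (chart P (sval a).1) (- ord C x (pbar_sec a))].
Proof.
move=> [q [hx xi hq] qj]; split=> //; rewrite /pbar_sec (ordV hx) opprK.
by have [] := specializes_minord hx hq qj.
Qed.

Lemma pbar_unramified P : det_unramified (Pbar_O1 rho tau P).
Proof.
move=> x a b hx /pbar_chart_minord [_ xa ma] /pbar_chart_minord [_ xb mb].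
have a0 := svalP a; have b0 := svalP b; rewrite det_scalar expr1 (ord_div hx b0 a0).
have := chart_minord_eq hx xa xb ma mb; rewrite /pbar_sec !(ordV hx) !opprK => ->.
by rewrite subrr.
Qed.

Lemma pbar_exists P i x : kpts C x -> copen i x -> exists q, pbar P i x q.
Proof.
move=> hx xi; have [m hm] := minord_exists x (chart_vec_neq0 P i).
by have [q hq _] := minord_specializes hx hm; exists q.
Qed.

Lemma pbar_trivialization P i x q : pbar P i x q ->
  exists2 a, @copen _ _ _ (Pbar_O1 rho tau P) a x &
    exists c, [/\ c != 0, ord C x c = ord C x (pbar_sec a) &
    forall j : 'I_v, regval C x (c * chart P i j 0) (hvec q j 0)].
Proof.
move=> hq; have [hx xi sq] := hq; have [j qj] := hvec_coord q.
have [yj _] := specializes_minord hx sq qj.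
exists (exist _ (i, j) yj); first by exists q.
have [c c0 hc] := sq; exists c; split=> //.
have uj : unit_at x (c * chart P i j 0) by exists (hvec q j 0).
have := ord_unit hx uj; rewrite (ordM hx) // /pbar_sec (ordV hx) => /eqP.
by rewrite addr_eq0 => /eqP.
Qed.

(** In one chart [i0], whose domain is cofinite, the least order of the coordinates is 0 at almost
    all points; [chart_minord_eq] carries this to every other chart. *)
Lemma pbar_support P : exists S : seq (pspace k N1),
  forall x (a : cidx (Pbar_O1 rho tau P)), kpts C x -> x \notin S ->
    copen a x -> ord C x (pbar_sec a) = 0.
Proof.
have [[i0 _]|none] := pselect (exists i : cidx E, True); last first.
  by exists [::] => x a; case: none; exists (sval a).1.
have [S hS] := copen_cofinite i0.
have /cV0Pn [j0 yj0] := chart_vec_neq0 P i0; have [S1 hS1] := almost_unit yj0.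
have [S2 hS2] := almost_regular (fun j : 'I_v => chart P i0 j 0).
exists (S ++ S1 ++ S2) => x a hx; rewrite !mem_cat !negb_or => /and3P [xS xS1 xS2].
move=> /pbar_chart_minord [_ xa ma].
suff m0 : minord x (chart P i0) 0.
  by have := chart_minord_eq hx xa (hS x hx xS) ma m0 => /eqP; rewrite oppr_eq0 => /eqP.
split; last by move=> j; apply/(vge0P hx); have [c hc] := hS2 x hx xS2; exists (c j).
by exists j0 => //; have [c c0 hc] := hS1 x hx xS1; apply: (ord_unit hx); exists c.
Qed.

End Bundle.

Lemma mulrn_int (z : int) (n : nat) : z *+ n = n%:Z * z.
Proof. by rewrite -mulr_natl natz. Qed.

(** * Comparison of heights *)

Section Local.
Variables (k : closedFieldType) (C : curve k) (e v : nat) (rho : glmorph k e v).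
Variables (gamma : int) (L : gitpol rho).
Local Notation K := (ffield C).
Local Notation io := (femb C).
Variables (E : cocycle C e) (tau : cidx E -> 'M[K]_e) (P : pspace K v).
Hypotheses (he : (0 < e)%N) (hrho : homog_weight rho gamma) (hE : vbundle E).
Hypotheses (htau : gtriv E tau) (hP : semistable rho io P).
Local Notation chart := (@chart_vec k C e v rho E tau).
Local Notation qbar := (qbar_O rho (pdeg L) P).
Local Notation pbar := (Pbar_O1 rho tau P).

Lemma ord_ginv_chart d g x (i : cidx E) : kpts C x -> ginv rho d g ->
  (evf io g (chart P i) != 0) = (evf io g (hvec P) != 0) /\
  (evf io g (hvec P) != 0 -> ord C x (evf io g (chart P i)) *+ e =
     ord C x (\det (tau i)) * (gamma * d%:Z) + ord C x (evf io g (hvec P)) *+ e).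
Proof.
move=> hx hg; have key := evf_ginv_pow (hvec P) he hrho hg (htau.1 i).
rewrite -/(chart P i) in key.
have det0 : \det (tau i) != 0 by rewrite -unitfE -unitmxE; apply: htau.1.
have nz : (evf io g (chart P i) != 0) = (evf io g (hvec P) != 0).
  have := congr1 (fun a => a != 0) key.
  by rewrite mulf_eq0 !expf_eq0 he expfz_eq0 (negPf det0) andbF.
split=> // gP; rewrite -!(ordX hx) ?nz // key (ordM hx) ?expfz_neq0 ?expf_neq0 //.
by rewrite (ordXz hx).
Qed.

(** The contribution of [x] to the difference of the two heights, multiplied by [e * pdeg L] to
    become an integer. *)
Let defect x : int :=
  e%:Z * (pdeg L)%:Z * secord pbar (fun a => pbar_sec a) x
  + gamma * (pdeg L)%:Z * secord E (fun i => \det (tau i)) x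
  - e%:Z * secord qbar (fun f => qbar_sec f) x.

(** For an invariant [f] of least order at [x], the defect is [e] times the excess of the order of
    [f] on the chart coordinates over [pdeg L] times the least order of these coordinates. By
    [ord_homog] this excess is nonnegative. *)
Lemma local_height x (i : cidx E) : kpts C x -> copen i x ->
  0 <= defect x /\ forall q, @Pbar _ _ _ _ rho _ tau P i x q ->
    (defect x = 0 <-> semistable rho idfun q).
Proof.
move=> hx xi; suff H q : @Pbar _ _ _ _ rho _ tau P i x q ->
    0 <= defect x /\ (defect x = 0 <-> semistable rho idfun q).
  have [q /H [ge0 _]] := pbar_exists rho htau P hx xi.
  by split=> // q' /H [].
move=> hq; have [f [hf fP xf]] := qbar_cover L hP hx.
have [a xa [c [c0 oc hc]]] := pbar_trivialization hq.
have xf' : @copen _ _ _ qbar (exist _ f (conj hf fP)) x by [].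
have -> : defect x = e%:Z * (pdeg L)%:Z * ord C x c
    + gamma * (pdeg L)%:Z * ord C x (\det (tau i)) + e%:Z * ord C x (evf io f (hvec P)).
  have up : det_unramified pbar by apply: (pbar_unramified hE htau).
  have uq : det_unramified qbar by apply: qbar_unramified.
  rewrite /defect (secordE (bundle_unramified hE) (det_triv_detsec htau) hx xi).
  rewrite (secordE up (pbar_detsec rho tau P) hx xa) -oc.
  by rewrite (secordE uq (qbar_detsec L P) hx xf') /qbar_sec /= (ordV hx) mulrN opprK.
have hoc : ord C x c = - - ord C x c by rewrite opprK.
have [fnz /(_ fP) ford] := ord_ginv_chart i hx hf.
have fy : evf io f (chart P i) != 0 by rewrite fnz.
have [fge _ fval] := ord_homog hx hf.1 c0 hoc hc; rewrite vge_ord // in fge.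
have -> : e%:Z * (pdeg L)%:Z * ord C x c + gamma * (pdeg L)%:Z * ord C x (\det (tau i))
    + e%:Z * ord C x (evf io f (hvec P))
  = e%:Z * (ord C x (evf io f (chart P i)) - (- ord C x c) *+ pdeg L).
  move: ford; rewrite !mulrn_int mulrBr => ->; ring.
split; first by rewrite mulr_ge0 // subr_ge0.
split=> [/eqP|].
  rewrite mulf_eq0 subr_eq0 -[e%:Z == 0]/(e == 0)%N eqn0Ngt he /= => /eqP o.
  by exists (pdeg L), f; split=> //; [apply: pdeg_gt0|apply: fval].
(* An invariant [g] nonzero at [q] attains the lower bound. Passing to the chart shifts [e] times
   the order by the same amount for [f] and [g], so [f], being of least order, attains it too. *)
move=> /(semistable_pdeg L) [g hg gq].
have [_ /(_ gq) [gy og] _] := ord_homog hx hg.1 c0 hoc hc.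
have [gnz gord] := ord_ginv_chart i hx hg.
have gP : evf io g (hvec P) != 0 by rewrite -gnz.
suff ole : ord C x (evf io f (chart P i)) <= (- ord C x c) *+ pdeg L.
  suff -> : ord C x (evf io f (chart P i)) = (- ord C x c) *+ pdeg L by rewrite subrr mulr0.
  by apply/eqP; rewrite eq_le ole fge.
rewrite -og -(ler_pMn2r he) ford gord // lerD2l ler_pMn2r //.
exact: qbar_chart_le xf hg fP gP.
Qed.

End Local.

Lemma rat_height_diff (A B D g : int) (d e : nat) : (0 < d)%N -> (0 < e)%N ->
  B%:~R + g%:~R * (D%:~R / e%:R) - A%:~R / d%:R =
  (e%:Z * d%:Z * B + g * d%:Z * D - e%:Z * A)%:~R / (e%:R * d%:R) :> rat.
Proof.
move=> d0 e0; have d1 : d%:R != 0 :> rat by rewrite pnatr_eq0 -lt0n.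
have e1 : e%:R != 0 :> rat by rewrite pnatr_eq0 -lt0n.
rewrite rmorphB rmorphD !rmorphM /= -!pmulrn; field.
by apply/andP.
Qed.

Theorem theorem3p1 (k : closedFieldType) (C : curve k) (e v : nat)
  (he : (0 < e)%N) (hv : (0 < v)%N)
  (rho : glmorph k e v) (gamma : int) (hrho : homog_weight rho gamma)
  (L : gitpol rho)
  (E : cocycle C e) (hE : vbundle E)
  (tau : cidx E -> 'M[ffield C]_e) (htau : gtriv E tau)
  (P : pspace (ffield C) v) (hP : semistable rho (femb C) P) :
  ht_GIT L P <= ht_PE rho tau gamma P /\
  (ht_GIT L P = ht_PE rho tau gamma P <-> Pbar_semistable rho tau P).
Proof.
have cov x : kpts C x -> exists i : cidx E, copen i x by case: hE => _ + _ _ _; apply.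
have loc x := @local_height _ _ _ _ _ _ L _ _ _ he hrho hE htau hP x.
have [Sq hSq] := qbar_support L hP.
have [Sp hSp] := pbar_support rho hE htau P.
have [Sd hSd] := det_triv_support hE htau.
(* A common finite support on the curve for the three rational sections. *)
pose S := undup [seq x <- Sq ++ Sp ++ Sd | `[< kpts C x >]].
have uS : uniq S by apply: undup_uniq.
have kS x : x \in S -> kpts C x.
  by rewrite mem_undup mem_filter => /andP [/asboolP].
have nS x : kpts C x -> x \notin S -> [/\ x \notin Sq, x \notin Sp & x \notin Sd].
  move=> hx; rewrite mem_undup mem_filter (asboolT hx) /= !mem_cat !negb_or.
  by move=> /and3P [].
have covq x : kpts C x -> exists f : cidx (qbar_O rho (pdeg L) P), copen f x.
  move=> hx; have [f [hf fP xf]] := qbar_cover L hP hx.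
  by exists (exist _ f (conj hf fP)).
have covp x : kpts C x -> exists a : cidx (Pbar_O1 rho tau P), copen a x.
  move=> hx; have [i xi] := cov x hx.
  have [q hq] := pbar_exists rho htau P hx xi.
  by have [a xa _] := pbar_trivialization hq; exists a.
have up : det_unramified (Pbar_O1 rho tau P) by apply: (pbar_unramified hE htau).
have uq : det_unramified (qbar_O rho (pdeg L) P) by apply: qbar_unramified.
have degq := deg_secord covq uq (qbar_detsec L P) uS kS.
have degp := deg_secord covp up (pbar_detsec rho tau P) uS kS.
have degd := deg_secord cov (bundle_unramified hE) (det_triv_detsec htau) uS kS.
have {}degq := degq (fun x f hx xS xf => hSq x f hx (let: And3 h _ _ := nS x hx xS in h) xf).
have {}degp := degp (fun x a hx xS xa => hSp x a hx (let: And3 _ h _ := nS x hx xS in h) xa).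
have {}degd := degd (fun x i hx xS xi => hSd x i hx (let: And3 _ _ h := nS x hx xS in h) xi).
have diff := rat_height_diff (deg (qbar_O rho (pdeg L) P)) (deg (Pbar_O1 rho tau P))
  (deg E) gamma (pdeg_gt0 L) he.
have pos : 0 < e%:R * (pdeg L)%:R :> rat by rewrite mulr_gt0 ?ltr0n // pdeg_gt0.
pose defect x : int :=
  e%:Z * (pdeg L)%:Z * secord (Pbar_O1 rho tau P) (fun a => pbar_sec a) x
  + gamma * (pdeg L)%:Z * secord E (fun i => \det (tau i)) x
  - e%:Z * secord (qbar_O rho (pdeg L) P) (fun f => qbar_sec f) x.
have {}diff : ht_PE rho tau gamma P - ht_GIT L P =
    (\sum_(x <- S) defect x)%:~R / (e%:R * (pdeg L)%:R).
  rewrite /ht_PE /ht_GIT /slope diff degq degp degd !mulr_sumr -big_split -sumrB.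
  by [].
have defect_ge0 x : x \in S -> 0 <= defect x.
  by move=> /kS hx; have [i xi] := cov x hx; have [] := loc x i hx xi.
split.
  rewrite -subr_ge0 diff; apply: divr_ge0; last exact: ltW.
  by rewrite ler0z big_seq sumr_ge0.
(* A sum of nonnegative integers vanishes only if every term does. *)
have -> : ht_GIT L P = ht_PE rho tau gamma P <-> forall x, x \in S -> defect x = 0.
  rewrite (rwP eqP) eq_sym -subr_eq0 diff mulf_eq0 invr_eq0 (gt_eqF pos) orbF intr_eq0.
  rewrite big_seq psumr_eq0 //.
  split=> [/allP h x xS|h]; first by have := h x xS; rewrite xS => /eqP.
  by apply/allP => x xS; rewrite h // eqxx implybT.
split=> [h i x hx xi|h x xS].
  have [q hq] := pbar_exists rho htau P hx xi; exists q => //.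
  have [_ /(_ q hq) ss] := loc x i hx xi; apply/ss.
  (* Outside [S] the three sections have order 0, so the defect vanishes there in any case. *)
  have [/h //|xS] := boolP (x \in S); have [xq xp xd] := nS x hx xS.
  have [f xf] := covq x hx; have [a xa] := covp x hx.
  rewrite (secordE up (pbar_detsec rho tau P) hx xa) hSp //.
  rewrite (secordE uq (qbar_detsec L P) hx xf) hSq //.
  rewrite (secordE (bundle_unramified hE) (det_triv_detsec htau) hx xi) hSd //.
  by rewrite !mulr0 addr0 subr0.
have hx := kS x xS; have [i xi] := cov x hx; have [q hq ssq] := h i x hx xi.
by have [_ /(_ q hq) ss] := loc x i hx xi; apply/ss.
Qed.
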